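(* Let $S$ be a countably infinite set with symmetric conductances $c_{x,y}=c_{y,x}\in[0,+\infty)$ satisfying Assumption SSEP, and let $\mathcal L$ with domain $\mathcal D(\mathcal L)$ be the Markov generator of the symmetric simple exclusion process with conductances $c_{x,y}$. Then local functions belong to $\mathcal D(\mathcal L)$. Moreover, for any local function $f$, $$\mathcal L f(\eta)=\sum_{x\in S}\sum_{y\in S}c_{x,y}\,\eta(x)\big(1-\eta(y)\big)\big[f(\eta^{x,y})-f(\eta)\big],\qquad \eta\in\{0,1\}^S,$$ and $$\mathcal L f(\eta)=\sum_{\{x,y\}\in\mathcal E_S}c_{x,y}\big[f(\eta^{x,y})-f(\eta)\big],\qquad \eta\in\{0,1\}^S.$$ The sums in the right-hand sides of both identities are absolutely convergent series of functions in $C(\{0,1\}^S)$.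
   Context: Setting. $S$ is a countably infinite set, $\mathcal E_S:=\{\{x,y\}: x\ne y,\ x,y\in S\}$. To each $\{x,y\}\in\mathcal E_S$ is associated a number $c_{x,y}=c_{y,x}\in[0,+\infty)$; $c_{x,x}:=0$. Assumption SSEP: (C1) $c_x:=\sum_{y\in S}c_{x,y}<+\infty$ for all $x\in S$; (C2) for each $x\in S$ the continuous-time random walk on $S$ starting at $x$ with jump rates $c_{y,z}$ (at $y$ it waits an exponential time of mean $1/c_y\in(0,+\infty]$, then jumps to $z$ with probability $c_{y,z}/c_y$) a.s. does not explode. Path spaces. For a metric space $W$, $D_W=D(\mathbb R_+,W)$ is the space of càdlàg paths $\mathbb R_+=[0,+\infty)\to W$ with the Skorohod topology and its Borel $\sigma$-algebra. $\mathbb N=\{0,1,\dots\}$ is discrete; $\{0,1\}^S$ has the product topology. $D_{\mathbb N}^{\mathcal E_S}$ has the product topology; its generic element is $\mathcal K=(\mathcal K_{x,y})_{\{x,y\}\in\mathcal E_S}$, with $\mathcal K_{x,y}=\mathcal K_{y,x}$. $\mathbb P$ (with expectation $\mathbb E$) is the law on $D_{\mathbb N}^{\mathcal E_S}$ of a family $(N_{x,y}(\cdot))_{\{x,y\}\in\mathcal E_S}$ of independent Poisson processes, $N_{x,y}$ having intensity $c_{x,y}$ and $N_{x,y}(0)=0$. Graphical construction. Let $\mathcal K_x(t):=\sum_{y\in S\setminus\{x\}}\mathcal K_{x,y}(t)$. $\Gamma$ is the set of $\mathcal K$ such that: (i) for all $x\in S$, $\mathcal K_x$ is finite-valued and càdlàg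 with jumps equal to $+1$; (ii) each $\mathcal K_{x,y}$ has only jumps equal to $+1$; (iii) for $\{x,y\}\neq\{x',y'\}$ the sets of jump times of $\mathcal K_{x,y}$ and $\mathcal K_{x',y'}$ are disjoint; (iv) $\mathcal K_{x,y}(0)=0$ for all $\{x,y\}$. For $\mathcal K\in\Gamma$, $t\ge0$, $x\in S$ define $X_t^x[\mathcal K]\in S\cup\{\partial\}$ ($\partial\notin S$ an abstract state): if $\mathcal K_x$ has no jump times in $[0,t]$, set $X^x_t[\mathcal K]:=x$; otherwise let $t_1$ be the largest jump time of $\mathcal K_x$ in $[0,t]$ and $x_1$ the unique site such that $t_1$ is a jump time of $\mathcal K_{x,x_1}$. Given $(t_k,x_k)$, $k\ge1$: if $\mathcal K_{x_k}$ has no jump times in $[0,t_k)$, set $X_t^x[\mathcal K]:=x_k$ and stop; otherwise let $t_{k+1}$ be the largest one and $x_{k+1}$ the unique site such that $t_{k+1}$ is a jump time of $\mathcal K_{x_k,x_{k+1}}$. If the algorithm never stops, $X_t^x[\mathcal K]:=\partial$. Let $\Gamma_*:=\{\mathcal K\in\Gamma: X_t^x[\mathcal K]\in S\ \forall x\in S,\ t\ge0\}$; it is Borel and $\mathbb P(\Gamma_* )=1$. For $\mathcal K\in\Gamma_*$ and $\sigma\in\{0,1\}^S$ set $\eta_t^\sigma[\mathcal K](x):=\sigma(X_t^x[\mathcal K])$. Semigroup and generator. $C(\{0,1\}^S)$ is the space of real continuous functions with the uniform norm. $S(t)f(\sigma):=\mathbb E[f(\eta^\sigma_t[\mathcal K])]$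 defines a strongly continuous Markov semigroup on $C(\{0,1\}^S)$, the semigroup of the symmetric simple exclusion process (SSEP). Its generator $\mathcal L$ has domain $\mathcal D(\mathcal L)=\{f\in C(\{0,1\}^S): \lim_{t\downarrow0}(S(t)f-f)/t\text{ exists in }C(\{0,1\}^S)\}$ and $\mathcal L f$ is that limit. $\eta^{x,y}$ is obtained from $\eta$ by exchanging the values at $x$ and $y$. A function $f:\{0,1\}^S\to\mathbb R$ is local if for some finite $A\subset S$, $f(\eta)$ is determined by $(\eta(x))_{x\in A}$. Absolutely convergent series in $C(\{0,1\}^S)$: the sum of the uniform norms of the terms is finite. *)

(* Defs.v *)
From mathcomp Require Import all_boot all_order all_algebra finmap.
From mathcomp Require Import all_classical all_reals all_analysis measurable_realfun.

Set Implicit Arguments.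
Unset Strict Implicit.
Unset Printing Implicit Defensive.

Import Order.TTheory GRing.Theory Num.Theory.
Import numFieldNormedType.Exports.

Local Open Scope classical_set_scope.
Local Open Scope ring_scope.

(* Paths are functions on the whole of R of which only the restriction to
   [0, +oo) is ever used. *)
Section paths.
Context {R : realType}.

Definition cadlag {W : topologicalType} (f : R -> W) : Prop :=
  (forall t, 0 <= t -> f s @[s --> t^'+] --> f t) /\
  (forall t, 0 < t -> exists l : W, f s @[s --> t^'-] --> l).

(* For a càdlàg path into a Hausdorff space: f(t-) <> f(t). *)
Definition jump_time {W : topologicalType} (f : R -> W) (t : R) : Prop :=
  0 < t /\ ~ (f s @[s --> t^'-] --> f t).

Definition unit_jumps (f : R -> R) : Prop :=
  forall t, jump_time f t -> f s @[s --> t^'-] --> f t - 1.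

End paths.

(* The unordered pair {x, y} of distinct sites is represented by whichever of
   (x, y), (y, x) is increasing for the enumeration [pickle] of S. *)
Definition edge (S : countType) : Type :=
  {p : S * S | (choice.pickle p.1 < choice.pickle p.2)%N}.

Definition efst {S : countType} (e : edge S) : S := (val e).1.
Definition esnd {S : countType} (e : edge S) : S := (val e).2.

Section conductances.
Context {R : realType} {S : countType}.
Variable c : S -> S -> R.

Definition site_rate_ereal (x : S) : \bar R :=
  \esum_(y in [set: S]) (c x y)%:E.
Definition site_rate (x : S) : R := fine (site_rate_ereal x).

(* A site of rate 0 is never left (the holding time there is +oo); the value
   given to the jump chain after such a site is irrelevant, and it is taken
   to stay put. *)
Definition jump_prob (y z : S) : R :=
  if site_rate y == 0 then (z == y)%:R else c y z / site_rate y.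

(* Z is the sequence of visited sites and T the sequence of holding times: Z is
   the jump chain started at x and, given Z, the T k are independent
   exponential variables of parameter site_rate (Z k), infinite when this
   parameter is 0. *)
Definition random_walk {d} {Om : measurableType d} (P : probability Om R)
    (x : S) (Z : nat -> Om -> S) (T : nat -> Om -> \bar R) : Prop :=
  [/\ forall n y, measurable (Z n @^-1` [set y]),
      forall n, measurable_fun [set: Om] (T n),
      forall n w, (0 <= T n w)%E &
      forall (n : nat) (y : nat -> S) (s : nat -> R), (forall k, 0 <= s k) ->
        P [set w | forall k, (k <= n)%N -> Z k w = y k /\ ((s k)%:E < T k w)%E]
        = ((y 0%N == x)%:R * (\prod_(k < n) jump_prob (y k) (y k.+1))
           * \prod_(k < n.+1) expR (- (site_rate (y k) * s k)))%:E].

Definition non_explosive : Prop :=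
  forall (x : S) (d : measure_display) (Om : measurableType d)
    (P : probability Om R) (Z : nat -> Om -> S) (T : nat -> Om -> \bar R),
  random_walk P x Z T ->
  {ae P, forall w, (\sum_(0 <= n <oo) T n w = +oo)%E}.

End conductances.

Section poisson.
Context {R : realType} {d} {Om : measurableType d}.
Variable P : probability Om R.

(* Not the library's [poisson_pmf], which is constantly 1 at rate 0. *)
Definition poisson_weight (r : R) (k : nat) : R :=
  r ^+ k / k`!%:R * expR (- r).

Definition poisson_process (lambda : R) (N : R -> Om -> nat) : Prop :=
  [/\ forall t, 0 <= t -> measurable_fun [set: Om] (N t),
      forall w, N 0 w = 0%N,
      forall w, cadlag (N ^~ w) &
      forall (n : nat) (s : nat -> R) (k : nat -> nat), 0 <= s 0%N ->
        (forall i, s i <= s i.+1) ->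
        P [set w | forall i, (i < n)%N -> N (s i.+1) w = (N (s i) w + k i)%N]
        = (\prod_(i < n) poisson_weight (lambda * (s i.+1 - s i)) (k i))%:E].

Definition process_sigma_algebra (N : R -> Om -> nat) : set (set Om) :=
  <<s [set A | exists t (B : set nat), 0 <= t /\ A = N t @^-1` B] >>.

Definition mutually_independent {I : choiceType} (G : I -> set (set Om)) :
    Prop :=
  forall (J : {fset I}) (A : I -> set Om),
    (forall i, i \in J -> G i (A i)) ->
    P (\bigcap_(i in [set` J]) A i) = (\prod_(i <- J) P (A i))%E.

Definition poisson_family {S : countType} (c : S -> S -> R)
    (N : S -> S -> R -> Om -> nat) : Prop :=
  [/\ forall x y, N x y = N y x,
      forall x y, x != y -> poisson_process (c x y) (N x y) &
      mutually_independent
        (fun e : edge S => process_sigma_algebra (N (efst e) (esnd e)))].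

End poisson.

Section graphical_construction.
Context {R : realType} {S : countType}.
(* K x x plays no role. *)
Implicit Types K : S -> S -> R -> nat.

Definition edge_path K (x y : S) (t : R) : R := (K x y t)%:R.

Definition site_path_ereal K (x : S) (t : R) : \bar R :=
  \esum_(y in [set y | y != x]) (edge_path K x y t)%:E.
Definition site_path K (x : S) (t : R) : R := fine (site_path_ereal K x t).

Definition Gamma : set (S -> S -> R -> nat) :=
  [set K |
    (* K is an element of the product path space *)
    [/\ forall x y, K x y = K y x & forall x y, x != y -> cadlag (K x y)] /\
    [/\ forall x, [/\ forall t, 0 <= t -> (site_path_ereal K x t < +oo)%E,
                      cadlag (site_path K x) & unit_jumps (site_path K x)],
        forall x y, x != y -> unit_jumps (edge_path K x y),
        forall e e' : edge S, e != e' -> forall t,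
          ~ (jump_time (edge_path K (efst e) (esnd e)) t /\
             jump_time (edge_path K (efst e') (esnd e')) t) &
        forall x y, x != y -> K x y 0 = 0%N]].

Definition last_jump K (x : S) (I : set R) (t : R) : Prop :=
  [/\ I t, jump_time (site_path K x) t &
      forall s, I s -> jump_time (site_path K x) s -> s <= t].

(* [backward K I x z]: the backward algorithm that is at x and looks for jump
   times in the window I stops, after finitely many steps, with output z. *)
Inductive backward K : set R -> S -> S -> Prop :=
| backward_stop I x :
    (forall s, I s -> ~ jump_time (site_path K x) s) -> backward K I x x
| backward_step I x t y z :
    last_jump K x I t -> y != x -> jump_time (edge_path K x y) t ->
    backward K `[0, t[%classic y z -> backward K I x z.

(* None is the abstract state reached when the algorithm never stops; it is
   also the value given to configurations outside of Gamma. *)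
Definition Xpos K (t : R) (x : S) : option S :=
  xget None [set Some z | z in
    [set z | Gamma K /\ backward K `[0, t]%classic x z]].

Definition conf : Type := {ptws S -> bool}.

(* The value [false] where Xpos = None is a convention: for the law of the
   Poisson family, almost surely Xpos K t x is a site for all t >= 0 and x. *)
Definition eta K (t : R) (sigma : conf) : conf :=
  fun x => oapp sigma false (Xpos K t x).

Definition exchange (eta : conf) (x y : S) : conf :=
  fun z => if z == x then eta y else if z == y then eta x else eta z.

Definition local_fun (f : conf -> R) : Prop :=
  exists2 A : set S, finite_set A &
    forall eta zeta : conf, (forall x, A x -> eta x = zeta x) ->
      f eta = f zeta.

Definition uniform_norm (f : conf -> R) : \bar R :=
  ereal_sup [set `|f eta|%:E | eta in [set: conf]].

(* Sum of a family of real numbers, as a limit along the finite subfamilies. *)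
Definition family_sum {I : choiceType} (u : I -> R) : R :=
  lim ((fun A : {fset I} => \sum_(i <- A) u i) @
       filter_from [set: {fset I}] (fun A => [set B | A `<=` B]%fset)).

Definition abs_convergent_in_C {I : choiceType} (F : I -> conf -> R) : Prop :=
  (forall i, continuous (F i)) /\
  (\esum_(i in [set: I]) uniform_norm (F i) < +oo)%E.

End graphical_construction.

Arguments conf : clear implicits.

Section semigroup.
Context {R : realType} {S : countType} {d} {Om : measurableType d}.
Variables (P : probability Om R) (N : S -> S -> R -> Om -> nat).

Definition semigroup (t : R) (f : conf S -> R) : conf S -> R :=
  fun sigma =>
    fine 'E_P[(fun w => f (eta (fun x y s => N x y s w) t sigma))].

Definition difference_quotient (f : conf S -> R) (t : R) : conf S -> R :=
  fun sigma => (semigroup t f sigma - f sigma) / t.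

Definition generator_limit (f g : conf S -> R) : Prop :=
  continuous g /\ {uniform, difference_quotient f t @[t --> 0^'+] --> g}.

Definition generator_domain : set (conf S -> R) :=
  [set f | continuous f /\ exists g, generator_limit f g].

(* The limit is unique when it exists; outside of the domain the value is
   irrelevant. *)
Definition generator (f : conf S -> R) : conf S -> R :=
  xget (fun=> 0) [set g | generator_limit f g].

End semigroup.

(* Main.v *)
Require Import Defs.
From mathcomp Require Import all_boot all_order all_algebra finmap.
From mathcomp Require Import all_classical all_reals all_analysis measurable_realfun.
From mathcomp Require Import ring lra zify.

Set Implicit Arguments.
Unset Strict Implicit.
Unset Printing Implicit Defensive.

Import Order.TTheory GRing.Theory Num.Theory.
Import numFieldNormedType.Exports.

Local Open Scope classical_set_scope.
Local Open Scope ring_scope.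

(** A local function f depends on the sites of a finite set A, and the edges
    meeting A have finite total rate.  In a short time t the configuration
    seen on A therefore behaves as if at most one of these edges had rung:

    - with no ring at an edge meeting A, eta_t = sigma on A;
    - if the edge e meets A and rings once, while no other edge meeting A or
      an endpoint of e rings, the backward algorithm makes one step and
      eta_t = sigma^e on A ([eta_jump]).

    To turn this into a uniform estimate, fix eps > 0 and a finite set F of
    edges outside of which the edges meeting A have total rate at most eps.
    The linearization
      h = f(sigma) + sum_(e in F) 1{N_e(t) = 1} (f(sigma^e) - f(sigma))
    equals f(eta_t) off three events: an edge outside F meeting A rings
    (probability at most eps t), an edge of F rings twice, or an edge of F and
    another edge close to it both ring (both of probability O(t^2), with a
    constant depending on F).  On the first event alone h is still f(sigma),
    so the large constant, of order M |F|, bounding h only multiplies O(t^2).  Since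
    E[h] = f(sigma) + t sum_(e in F) c_e (f(sigma^e) - f(sigma)) + O(t^2), the
    difference quotient is within 4 M eps + C t of the series over all edges,
    uniformly in sigma ([difference_quotient_estimate]).

    Two points need care.  First, X_t^x is only meaningful on Gamma, so
    Gamma must have full probability.  Only the values of the Poisson processes
    on grids are used: on a grid of mesh 1/m over a bounded interval, the
    probability that some increment is not 0 or 1, or that two given edges ring
    in the same cell, is O(1/m), hence almost surely some grid separates all
    the jumps ([grid_negligible]).  Right-continuity then gives monotone paths,
    unit jumps and disjoint jump times; a union bound gives local finiteness
    of K_x ([regular_ae], [regular_Gamma]).  Second, w |-> f(eta_t) need not be
    known to be measurable.  The integral of any function is a difference of
    suprema over simple functions and is therefore monotone, so it is enough
    to enclose f(eta_t) between two simple functions ([expectation_approx]).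

    Finally the sum over ordered pairs is folded onto unordered edges:
    eta(x)(1 - eta(y)) + eta(y)(1 - eta(x)) is the indicator of
    eta(x) <> eta(y), and the exchange does nothing when eta(x) = eta(y)
    ([generator_series_pairs]). *)

(** * Unconditional sums *)

Section summation.
Context {R : realType}.

Lemma esum_subset (T : choiceType) (A B : set T) (a : T -> \bar R) :
  A `<=` B -> (\esum_(i in A) a i <= \esum_(i in B) a i)%E.
Proof.
move=> AB; apply: le_ereal_sup => _ [X [Xfin XA] <-].
by exists X => //; split => // x /XA /AB.
Qed.

Lemma esumZ_le (T : choiceType) (D : set T) (u : T -> R) (a s : R) :
  0 <= a -> (\esum_(i in D) (u i)%:E <= s%:E)%E ->
  (\esum_(i in D) (a * u i)%:E <= (a * s)%:E)%E.
Proof.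
move=> a0 us; apply: ge_ereal_sup => _ [X [finX XD] <-].
rewrite fsbig_finite//= sumEFin -mulr_sumr lee_fin ler_wpM2l// -lee_fin.
apply: le_trans us; apply: esum_ge; exists X => //.
by rewrite fsbig_finite//= sumEFin.
Qed.

Lemma sum_le_esum (T : choiceType) (u : T -> R) (A : {fset T}) :
  ((\sum_(i <- A) u i)%:E <= \esum_(i in [set: T]) (u i)%:E)%E.
Proof.
apply: esum_ge; exists [set` A] => //.
by rewrite fsbig_finite//= set_fsetK sumEFin.
Qed.

Lemma fset_esum (T : choiceType) (u : T -> R) (A : {fset T}) :
  (forall i, 0 <= u i) ->
  \esum_(i in [set` A]) (u i)%:E = (\sum_(i <- A) u i)%:E.
Proof.
move=> u0; rewrite esum_fset ?fsbig_finite//= ?set_fsetK ?sumEFin// => i _.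
by rewrite lee_fin.
Qed.

Lemma esum_split_fset (T : choiceType) (u : T -> R) (A : {fset T}) :
  (forall i, 0 <= u i) ->
  (\esum_(i in [set: T]) (u i)%:E =
   (\sum_(i <- A) u i)%:E + \esum_(i in ~` [set` A]) (u i)%:E)%E.
Proof.
move=> u0; rewrite (esumID [set` A]) ?setTI; last by move=> i _; rewrite lee_fin.
by rewrite fset_esum.
Qed.

Lemma esum_adherent (T : choiceType) (u : T -> R) (eps : R) :
  (forall i, 0 <= u i) -> (\esum_(i in [set: T]) (u i)%:E < +oo)%E -> 0 < eps ->
  exists A : {fset T}, fine (\esum_(i in [set: T]) (u i)%:E) - eps
     < \sum_(i <- A) u i.
Proof.
move=> u0 ufin eps0.
have fn : \esum_(i in [set: T]) (u i)%:E \is a fin_num.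
  by rewrite ge0_fin_numE// esum_ge0// => i _; rewrite lee_fin.
have [_ [X [Xfin _] <-] lt] := ub_ereal_sup_adherent eps0 fn.
exists (fset_set X); rewrite -lte_fin EFinB fineK//.
by rewrite fsbig_finite//= sumEFin in lt.
Qed.

(** A finite set of indices carries all but eps of a summable family; every
    truncation to finitely many edges or sites comes from here. *)
Lemma esum_small_tail (T : choiceType) (u : T -> R) (eps : R) :
  (forall i, 0 <= u i) -> (\esum_(i in [set: T]) (u i)%:E < +oo)%E -> 0 < eps ->
  exists A : {fset T}, (\esum_(i in ~` [set` A]) (u i)%:E <= eps%:E)%E.
Proof.
move=> u0 ufin eps0; have [A hA] := esum_adherent u0 ufin eps0.
have tot := esum_split_fset A u0.
have tfin : \esum_(i in ~` [set` A]) (u i)%:E \is a fin_num.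
  rewrite ge0_fin_numE; last by rewrite esum_ge0// => i _; rewrite lee_fin.
  by apply: le_lt_trans ufin; exact: esum_subset.
exists A; rewrite -(fineK tfin) lee_fin.
move: tot hA; rewrite -(fineK tfin) => -> /=; lra.
Qed.

(** Two finite sets are both contained in their union: the filter along which
    [family_sum] is taken is proper. *)
#[local] Instance fset_filter (T : choiceType) :
  ProperFilter (filter_from [set: {fset T}] (fun A => [set B | A `<=` B]%fset)).
Proof.
apply: filter_from_proper; last by move=> A _; exists A => /=.
apply: filter_from_filter; first by exists fset0.
move=> A B _ _; exists (A `|` B)%fset => // C /=.
by rewrite fsubUset => /andP[].
Qed.

Lemma cvg_esum (T : choiceType) (u : T -> R) :
  (forall i, 0 <= u i) -> (\esum_(i in [set: T]) (u i)%:E < +oo)%E ->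
  (fun A : {fset T} => \sum_(i <- A) u i) @
    filter_from [set: {fset T}] (fun A => [set B | A `<=` B]%fset)
  --> fine (\esum_(i in [set: T]) (u i)%:E).
Proof.
move=> u0 ufin; apply/cvgrPdist_lt => eps eps0.
have [A hA] := esum_adherent u0 ufin eps0.
exists A => // B /= AB.
have fn : \esum_(i in [set: T]) (u i)%:E \is a fin_num.
  by rewrite ge0_fin_numE// esum_ge0// => i _; rewrite lee_fin.
have lB : \sum_(i <- B) u i <= fine (\esum_(i in [set: T]) (u i)%:E).
  by rewrite -lee_fin fineK// sum_le_esum.
have AB' : \sum_(i <- A) u i <= \sum_(i <- B) u i.
  rewrite [leRHS](big_fsetID _ (fun i => i \in A))/=.
  have -> : [fset x | x in B & x \in A]%fset = A.
    apply/fsetP => x; rewrite !inE/=; apply/andP/idP => [[]//|xA].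
    by split=> //; apply: (fsubsetP AB).
  by rewrite lerDl sumr_ge0.
rewrite ger0_norm; lra.
Qed.

Lemma family_sum_esum (T : choiceType) (p q : T -> R) :
  (forall i, 0 <= p i) -> (forall i, 0 <= q i) ->
  (\esum_(i in [set: T]) (p i)%:E < +oo)%E ->
  (\esum_(i in [set: T]) (q i)%:E < +oo)%E ->
  family_sum (fun i => p i - q i) =
  fine (\esum_(i in [set: T]) (p i)%:E) - fine (\esum_(i in [set: T]) (q i)%:E).
Proof.
move=> p0 q0 pfin qfin; apply/cvg_lim => //.
under eq_fun do rewrite big_split/= sumrN.
by apply: cvgB; apply: cvg_esum.
Qed.

(** Sums of real families are computed from the sums in [0, +oo] of their
    positive and negative parts, where rearrangement is free. *)
Definition pos_part (x : R) := Num.max x 0.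
Lemma pos_part_ge0 x : 0 <= pos_part x. Proof. by rewrite le_max lexx orbT. Qed.
Lemma pos_partB x : pos_part x - pos_part (- x) = x.
Proof. rewrite /pos_part; have [h|h] := leP x 0; have [h'|h'] := leP (- x) 0; lra. Qed.
Lemma pos_partD x : pos_part x + pos_part (- x) = `|x|.
Proof.
rewrite /pos_part; have [h|h] := leP x 0; have [h'|h'] := leP (- x) 0.
- have -> : x = 0 by lra.
  by rewrite normr0; lra.
- by rewrite ler0_norm//; lra.
- by rewrite gtr0_norm//; lra.
- lra.
Qed.
Lemma pos_part_le x r : `|x| <= r -> pos_part x <= r.
Proof. by move=> h; have := pos_partD x; have := pos_part_ge0 (- x); lra. Qed.

Section dominated.
Context {T : choiceType} (u r : T -> R).
Hypothesis ur : forall i, `|u i| <= r i.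
Hypothesis rfin : (\esum_(i in [set: T]) (r i)%:E < +oo)%E.

Lemma esum_pos_fin : (\esum_(i in [set: T]) (pos_part (u i))%:E < +oo)%E.
Proof.
by apply: le_lt_trans rfin; apply: le_esum => i _; rewrite lee_fin pos_part_le.
Qed.

Lemma esum_neg_fin : (\esum_(i in [set: T]) (pos_part (- u i))%:E < +oo)%E.
Proof.
apply: le_lt_trans rfin; apply: le_esum => i _.
by rewrite lee_fin pos_part_le// normrN.
Qed.

Lemma family_sum_posneg : family_sum u =
  fine (\esum_(i in [set: T]) (pos_part (u i))%:E)
  - fine (\esum_(i in [set: T]) (pos_part (- u i))%:E).
Proof.
rewrite -family_sum_esum; [|by move=> i; exact: pos_part_ge0..| |].
- by congr family_sum; apply/funext => i; rewrite pos_partB.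
- exact: esum_pos_fin.
- exact: esum_neg_fin.
Qed.

(** Bounding the tail through a dominating family r, instead of through u,
    makes the error uniform when u depends on a configuration. *)
Lemma family_sum_tail (A : {fset T}) (eps : R) :
  (\esum_(i in ~` [set` A]) (r i)%:E <= eps%:E)%E ->
  `|family_sum u - \sum_(i <- A) u i| <= eps.
Proof.
move=> tail; rewrite family_sum_posneg !(esum_split_fset A)//; [|by move=> i; exact: pos_part_ge0..].
set p := \esum_(i in _) _; set q := \esum_(i in _) _.
have p0 : (0 <= p)%E by apply: esum_ge0 => i _; rewrite lee_fin pos_part_ge0.
have q0 : (0 <= q)%E by apply: esum_ge0 => i _; rewrite lee_fin pos_part_ge0.
have pq : (p + q <= eps%:E)%E.
  apply: le_trans tail; rewrite -esumD; [|by move=> i _; rewrite lee_fin pos_part_ge0..].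
  by apply: le_esum => i _; rewrite -EFinD pos_partD lee_fin.
have pf : p \is a fin_num.
  rewrite ge0_fin_numE//; apply: le_lt_trans (ltry eps).
  by apply: le_trans pq; rewrite leeDl.
have qf : q \is a fin_num.
  rewrite ge0_fin_numE//; apply: le_lt_trans (ltry eps).
  by apply: le_trans pq; rewrite leeDr.
move: pq p0 q0; rewrite -(fineK pf) -(fineK qf) -EFinD !lee_fin => pq p0 q0.
have -> : \sum_(i <- A) u i =
   \sum_(i <- A) pos_part (u i) - \sum_(i <- A) pos_part (- u i).
  by rewrite -sumrB; apply: eq_bigr => i _; rewrite pos_partB.
rewrite /= ler_norml; apply/andP; split; lra.
Qed.

End dominated.

(** Fubini for dominated double series: positive and negative parts are
    summed separately, each by the interchange of sums in [0, +oo]. *)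
Lemma family_sum2 (T1 T2 : choiceType) (u r : T1 * T2 -> R) :
  (forall i, `|u i| <= r i) -> (\esum_(i in [set: T1 * T2]) (r i)%:E < +oo)%E ->
  family_sum (fun x => family_sum (fun y => u (x, y))) =
  fine (\esum_(i in [set: T1 * T2]) (pos_part (u i))%:E)
  - fine (\esum_(i in [set: T1 * T2]) (pos_part (- u i))%:E).
Proof.
move=> ur rfin.
have iter (g : T1 * T2 -> R) : (forall i, 0 <= g i) ->
    \esum_(x in [set: T1]) \esum_(y in [set: T2]) (g (x, y))%:E =
    \esum_(i in [set: T1 * T2]) (g i)%:E.
  move=> g0; rewrite (esum_esum (a := fun x y => (g (x, y))%:E)); last first.
    by move=> *; rewrite lee_fin.
  rewrite (_ : _ `*`` _ = setT); last by apply/seteqP.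
  by apply: eq_esum => -[].
have r0 i : 0 <= r i by apply: le_trans (ur i).
have rowfin x : (\esum_(y in [set: T2]) (r (x, y))%:E < +oo)%E.
  apply: le_lt_trans rfin; rewrite -iter//.
  rewrite -[leLHS](@esum_set1 _ _ x (fun x => \esum_(y in [set: T2]) (r (x, y))%:E)).
    exact: esum_subset.
  by apply: esum_ge0 => *; rewrite lee_fin.
have inner (g : T1 * T2 -> R) : (forall i, 0 <= g i) -> (forall i, g i <= r i) ->
    forall x, (fine (\esum_(y in [set: T2]) (g (x, y))%:E))%:E =
       \esum_(y in [set: T2]) (g (x, y))%:E.
  move=> g0 gr x; rewrite fineK// ge0_fin_numE; last first.
    by apply: esum_ge0 => *; rewrite lee_fin.
  by apply: le_lt_trans (rowfin x); apply: le_esum => *; rewrite lee_fin.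
have i1 := inner (fun i => pos_part (u i)) (fun i => pos_part_ge0 _) (fun i => pos_part_le (ur i)).
have nur i : `|- u i| <= r i by rewrite normrN.
have i2 := inner (fun i => pos_part (- u i)) (fun i => pos_part_ge0 _) (fun i => pos_part_le (nur i)).
rewrite (_ : (fun x => _) = (fun x =>
   fine (\esum_(y in [set: T2]) (pos_part (u (x, y)))%:E) -
   fine (\esum_(y in [set: T2]) (pos_part (- u (x, y)))%:E))); last first.
  by apply/funext => x; apply: (family_sum_posneg (r := fun y => r (x, y))).
have j1 := iter (fun i => pos_part (u i)) (fun i => pos_part_ge0 _).
have j2 := iter (fun i => pos_part (- u i)) (fun i => pos_part_ge0 _).
have k1 : \esum_(x in [set: T1])
    (fine (\esum_(y in [set: T2]) (pos_part (u (x, y)))%:E))%:E =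
    \esum_(i in [set: T1 * T2]) (pos_part (u i))%:E.
  by rewrite -j1; apply: eq_esum => x _; exact: i1.
have k2 : \esum_(x in [set: T1])
    (fine (\esum_(y in [set: T2]) (pos_part (- u (x, y)))%:E))%:E =
    \esum_(i in [set: T1 * T2]) (pos_part (- u i))%:E.
  by rewrite -j2; apply: eq_esum => x _; exact: i2.
rewrite family_sum_esum ?k1 ?k2//.
- by move=> x; rewrite fine_ge0// esum_ge0// => *; rewrite lee_fin pos_part_ge0.
- by move=> x; rewrite fine_ge0// esum_ge0// => *; rewrite lee_fin pos_part_ge0.
- exact: esum_pos_fin ur rfin.
- exact: esum_neg_fin ur rfin.
Qed.

(** Ordered pairs split into the edges, the reversed edges and the diagonal. *)
Lemma esum_pairs_edges (S : countType) (g : S * S -> R) :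
  (forall i, 0 <= g i) -> (forall x, g (x, x) = 0) ->
  \esum_(i in [set: S * S]) (g i)%:E =
  \esum_(e in [set: edge S])
     (g (efst e, esnd e) + g (esnd e, efst e))%:E.
Proof.
move=> g0 gd.
have g0' i : (0 <= (g i)%:E)%E by rewrite lee_fin.
under [RHS]eq_esum do rewrite EFinD.
rewrite esumD//.
pose B := [set p : S * S | (choice.pickle p.1 < choice.pickle p.2)%N].
pose C := [set p : S * S | (choice.pickle p.2 < choice.pickle p.1)%N].
rewrite (esumID B)// setTI; congr (_ + _)%E.
  rewrite -(esum_image [set: edge S] (fun e => (efst e, esnd e)) (fun i => (g i)%:E)).
    congr esum; apply/seteqP; split=> [[x y] xy|_ [e _ <-]].
      by exists (exist _ (x, y) xy).
    exact: valP e.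
  move=> [[x y] xy] [[x' y'] xy'] _ _ /= [? ?].
  by apply: val_inj => /=; congr pair.
rewrite -(esum_image [set: edge S] (fun e => (esnd e, efst e)) (fun i => (g i)%:E)); last first.
  move=> [[x y] xy] [[x' y'] xy'] _ _ /= [? ?].
  by apply: val_inj => /=; congr pair.
rewrite (_ : [set _ | _ in _] = C); last first.
  apply/seteqP; split=> [_ [e _ <-]|[x y] xy].
    exact: valP e.
  by exists (exist _ (y, x) xy).
rewrite setTI (esumID C)// [X in (_ + X)%E]esum1 ?adde0.
  by congr esum; apply/seteqP; split=> [p []//|p Cp]; split=> //; apply/negP; rewrite -leqNgt ltnW.
move=> [x y] [/= /negP]; rewrite -leqNgt => h1 /negP; rewrite -leqNgt => h2.
have -> : x = y by apply: (pcan_inj choice.pickleK); apply/eqP; rewrite eqn_leq h1 h2.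
by rewrite gd.
Qed.
End summation.

(** * Expectations and outer probabilities *)

Section probability_tools.
Context {R : realType} {d} {Om : measurableType d} (P : probability Om R).

(** The integral of a nonnegative function, measurable or not, is a supremum over
    the simple functions below it. *)
Lemma integral_mono (f g : Om -> \bar R) :
  (forall w, (f w <= g w)%E) -> (\int[P]_w f w <= \int[P]_w g w)%E.
Proof.
have ge0_mono (u v : Om -> \bar R) : (forall w, (0 <= u w)%E) ->
    (forall w, (u w <= v w)%E) -> (\int[P]_w u w <= \int[P]_w v w)%E.
  move=> u0 uv; rewrite !ge0_integralTE//; last first.
    by move=> w; apply: le_trans (uv w).
  apply: le_ereal_sup => _ [h hu <-]; exists h => // w.
  exact: le_trans (uv w).
move=> fg; rewrite integralE [leRHS]integralE; apply: leeB.
  apply: ge0_mono => // w; apply: (@funepos_le _ _ setT); rewrite ?inE//.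
apply: ge0_mono => // w; apply: (@funeneg_le _ _ setT); rewrite ?inE//.
Qed.

Lemma expectation_mono (X Y : Om -> R) :
  (forall w, X w <= Y w) -> ('E_P[X] <= 'E_P[Y])%E.
Proof. by move=> XY; rewrite unlock integral_mono// => w; rewrite lee_fin. Qed.

Lemma expectation_simple (s : seq (R * set Om)) :
  (forall i, i \in s -> measurable i.2) ->
  'E_P[fun w => (\sum_(i <- s) i.1 * \1_(i.2) w)%R]%E =
  (\sum_(i <- s) i.1 * fine (P i.2))%:E.
Proof.
move=> ms; rewrite unlock.
under eq_integral do rewrite -sumEFin.
have int (i : R * set Om) : i \in s ->
    P.-integrable setT (fun w => (i.1 * \1_(i.2) w)%:E).
  move=> /ms mi; under eq_fun do rewrite EFinM.
  by apply: integrableZl => //; apply: integrable_indic.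
have step : forall t : seq (R * set Om), {subset t <= s} ->
   P.-integrable setT (fun w => (\sum_(i <- t) (i.1 * \1_(i.2) w)%:E)%E) /\
   (\int[P]_w (\sum_(i <- t) (i.1 * \1_(i.2) w)%:E) = (\sum_(i <- t) i.1 * fine (P i.2))%:E)%E.
  elim=> [|i t IH] sub.
    split; first by under eq_fun do rewrite big_nil; exact: integrable0.
    by under eq_integral do rewrite big_nil; rewrite integral0 big_nil.
  have is_ : i \in s by apply: sub; rewrite mem_head.
  have [|It Et] := IH; first by move=> j jt; apply: sub; rewrite in_cons jt orbT.
  split.
    under eq_fun do rewrite big_cons.
    by apply: integrableD => //; exact: int.
  under eq_integral do rewrite big_cons.
  rewrite integralD//; last exact: int.
  rewrite Et big_cons EFinD; congr (_ + _)%E.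
  under eq_integral do rewrite EFinM.
  rewrite integralZl//; last first.
    by apply: integrable_indic; exact: ms.
  rewrite integral_indic//; last exact: ms.
  by rewrite setIT EFinM fineK// fin_num_measure//; exact: ms.
by have [_ ->] := step s (fun _ => id).
Qed.

(** Upper bounds on the outer probability.  They are stable under inclusions and
    countable unions, which lets one estimate bad events, such as the failure of
    a path property, without checking that they are measurable. *)
Definition outer_le (A : set Om) (r : \bar R) :=
  exists B, [/\ measurable B, A `<=` B & (P B <= r)%E].

Lemma outer_le_sub (A B : set Om) (r s : \bar R) :
  A `<=` B -> (r <= s)%E -> outer_le B r -> outer_le A s.
Proof.
move=> AB rs [C [mC BC PC]]; exists C; split => //.
- exact: subset_trans BC.
- exact: le_trans rs.
Qed.

(** The countable index type is transported to [nat] by [pickle_inv], whose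
    exactness ensures that no index is counted twice. *)
Lemma outer_le_bigcup (I : countType) (D : set I) (A : I -> set Om)
    (r : I -> \bar R) :
  (forall i, D i -> (0 <= r i)%E) -> (forall i, D i -> outer_le (A i) (r i)) ->
  outer_le (\bigcup_(i in D) A i) (\esum_(i in D) r i).
Proof.
move=> r0 Ar.
have [B hB] : exists B : I -> set Om, forall i, D i ->
    [/\ measurable (B i), A i `<=` B i & (P (B i) <= r i)%E].
  have /choice[B hB] : forall i, exists B, D i ->
      [/\ measurable B, A i `<=` B & (P B <= r i)%E].
    move=> i; have [Di|nDi] := pselect (D i); last by exists set0.
    by have [B hB] := Ar i Di; exists B.
  by exists B.
(* The events B i, reindexed by nat. *)
pose C n := if choice.pickle_inv n is Some i then
  (if i \in D then B i else set0) else set0.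
have mC n : measurable (C n).
  rewrite /C; case: choice.pickle_inv => [i|]//; case: ifPn => // /set_mem Di.
  by have [] := hB i Di.
exists (\bigcup_n C n); split.
- exact: bigcupT_measurable.
- move=> w [i Di Aiw]; exists (choice.pickle i) => //.
  rewrite /C choice.pickleK_inv mem_set//.
  by have [_ sub _] := hB i Di; exact: sub.
- apply: (le_trans (measure_sigma_subadditive P mC (bigcupT_measurable _ mC) (@subset_refl _ _))).
  rewrite nneseries_esumT// (esumID (choice.pickle @` D))//.
  rewrite setTI [X in (_ + X)%E]esum1 ?adde0; last first.
    move=> n [_ nD]; rewrite /C; have := choice.pickle_invK (T := I) n.
    case: choice.pickle_inv => [i|]//= ni.
    case: ifPn => // /set_mem Di; exfalso; apply: nD; by exists i.
  rewrite esum_image; last by move=> i j _ _; exact: (pcan_inj choice.pickleK).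
  apply: le_esum => i Di; rewrite /C choice.pickleK_inv mem_set//.
  by have [] := hB i Di.
Qed.

Lemma outer_leU (A B : set Om) (r s : \bar R) :
  outer_le A r -> outer_le B s -> outer_le (A `|` B) (r + s)%E.
Proof.
move=> [A' [mA AA PA]] [B' [mB BB PB]]; exists (A' `|` B'); split.
- exact: measurableU.
- exact: setUSS.
- by apply: le_trans (leeD PA PB); apply: measureU2.
Qed.

Lemma outer_le_negligible (A : set Om) :
  (forall eps : R, 0 < eps -> outer_le A eps%:E) -> P.-negligible A.
Proof.
move=> h.
have /choice[B hB] : forall n, exists B, [/\ measurable B, A `<=` B & (P B <= (n.+1%:R^-1)%:E)%E].
  by move=> n; apply: h.
have mB : measurable (\bigcap_n B n).
  by apply: bigcapT_measurable => n; have [] := hB n.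
exists (\bigcap_n B n); split => //; last first.
  by move=> w Aw n _; have [_ sub _] := hB n; exact: sub.
apply/eqP; rewrite -measure_le0; apply/lee_addgt0Pr => e e0; rewrite add0e.
have [n ne] : exists n, n.+1%:R^-1 < e :> R.
  exists (Num.truncn e^-1); rewrite invf_plt ?posrE//.
  exact: truncnS_gt.
apply: le_trans (_ : P (B n) <= _)%E.
  by apply: le_measure; rewrite ?inE//; [have [] := hB n|exact: bigcap_inf].
by have [_ _ /le_trans] := hB n; apply; rewrite lee_fin ltW.
Qed.

Lemma negligible_outer_le (A : set Om) : P.-negligible A -> outer_le A 0.
Proof. by move=> [B [mB PB AB]]; exists B; split => //; rewrite PB. Qed.

Lemma negligible_bigcup_count (I : countType) (A : I -> set Om) :
  (forall i, P.-negligible (A i)) -> P.-negligible (\bigcup_i A i).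
Proof.
move=> nA; apply: outer_le_negligible => e e0.
apply: (@outer_le_sub _ (\bigcup_i A i) (\esum_(i in [set: I]) 0)) => //.
  by rewrite esum1// lee_fin ltW.
by apply: outer_le_bigcup => // i _; exact: negligible_outer_le.
Qed.

End probability_tools.

(** * Increments of Poisson processes *)

Section poisson_increments.
Context {R : realType} {d} {Om : measurableType d} (P : probability Om R).
Variables (lambda : R) (N : R -> Om -> nat).
Hypothesis lambda_ge0 : 0 <= lambda.
Hypothesis N_poisson : poisson_process P lambda N.

Definition incr (a b : R) (k : nat) : set Om :=
  [set w | N b w = (N a w + k)%N].

Definition jumps (a b : R) : set Om := [set w | N b w <> N a w].

Lemma incr_bigcup a b k : incr a b k =
  \bigcup_j ((N a @^-1` [set j]) `&` (N b @^-1` [set (j + k)%N])).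
Proof.
apply/seteqP; split=> w /=; first by move=> e; exists (N a w).
by move=> [j _ [/= <- ?]].
Qed.

Lemma measurable_incr a b k : 0 <= a -> 0 <= b -> measurable (incr a b k).
Proof.
move=> a0 b0; have [mN _ _ _] := N_poisson.
rewrite incr_bigcup; apply: bigcupT_measurable => j; apply: measurableI.
  by rewrite -[X in measurable X]setTI; apply: mN.
by rewrite -[X in measurable X]setTI; apply: mN.
Qed.

Lemma jumpsE a b : jumps a b = ~` incr a b 0.
Proof. by apply/seteqP; split=> w /=; rewrite /jumps /incr /= addn0. Qed.

Lemma measurable_jumps a b : 0 <= a -> 0 <= b -> measurable (jumps a b).
Proof. by move=> a0 b0; rewrite jumpsE; apply: measurableC; exact: measurable_incr. Qed.

Lemma prob_incr a b k : 0 <= a -> a <= b ->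
  P (incr a b k) = (poisson_weight (lambda * (b - a)) k)%:E.
Proof.
move=> a0 ab; have [_ _ _ law] := N_poisson.
have := law 1%N (fun i => if i == 0%N then a else b) (fun _ => k) a0.
rewrite big_ord1 /= => <-; last by case.
congr (P _); apply/seteqP; split=> w /=; first by move=> h [|i].
by move=> /(_ 0%N isT).
Qed.

Lemma prob_jumps_le a b : 0 <= a -> a <= b ->
  (P (jumps a b) <= (lambda * (b - a))%:E)%E.
Proof.
move=> a0 ab; have b0 := le_trans a0 ab.
rewrite jumpsE probability_setC ?prob_incr//; last exact: measurable_incr.
rewrite /poisson_weight expr0 fact0 divr1 mul1r -EFinB lee_fin.
have := expR_ge1Dx (- (lambda * (b - a))); lra.
Qed.

(** With r the mean of the increment, the probability is
    1 - exp(-r) (1 + r) <= 1 - (1 - r) (1 + r) = r ^ 2. *)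
Lemma prob_multiple_jumps_le a b : 0 <= a -> a <= b ->
  outer_le P (~` (incr a b 0 `|` incr a b 1)) ((lambda * (b - a)) ^+ 2)%:E.
Proof.
move=> a0 ab; have b0 := le_trans a0 ab.
have m0 := measurable_incr 0 a0 b0; have m1 := measurable_incr 1 a0 b0.
exists (~` (incr a b 0 `|` incr a b 1)); split => //.
  by apply: measurableC; apply: measurableU.
rewrite probability_setC; last exact: measurableU.
set r := lambda * (b - a).
have -> : P (incr a b 0 `|` incr a b 1) =
    (poisson_weight r 0 + poisson_weight r 1)%:E.
  rewrite EFinD -!prob_incr//; apply: measureU => //.
  apply/seteqP; split=> // w [/=]; rewrite /incr /= => -> /eqP.
  by rewrite eqn_add2l.
rewrite /poisson_weight expr0 fact0 divr1 mul1r expr1 -EFinB lee_fin.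
have r0 : 0 <= r by rewrite mulr_ge0// subr_ge0.
have := expR_ge1Dx (- r) => h.
have : (1 - r) * (1 + r) <= expR (- r) * (1 + r) by rewrite ler_wpM2r//; lra.
rewrite invr1 !mulr1; nra.
Qed.

Lemma sigma_jumps a b : 0 <= a -> 0 <= b ->
  process_sigma_algebra N (jumps a b).
Proof.
move=> a0 b0.
set G := [set A | exists t (B : set nat), 0 <= t /\ A = N t @^-1` B].
have mgen t B : 0 <= t -> @measurable _ (g_sigma_algebraType G) (N t @^-1` B).
  by move=> t0; apply: sub_sigma_algebra; exists t, B.
change (@measurable _ (g_sigma_algebraType G) (jumps a b)).
rewrite jumpsE incr_bigcup; apply: measurableC.
by apply: bigcupT_measurable => j; apply: measurableI; exact: mgen.
Qed.

End poisson_increments.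

Section poisson_edges.
Context {R : realType} {S : countType} {d} {Om : measurableType d}.
Variables (P : probability Om R) (c : S -> S -> R).
Variable (N : S -> S -> R -> Om -> nat).
Hypothesis N_poisson : poisson_family P c N.

Definition edge_rate (e : edge S) : R := c (efst e) (esnd e).
Definition edge_process (e : edge S) : R -> Om -> nat := N (efst e) (esnd e).

Lemma edge_neq (e : edge S) : efst e != esnd e.
Proof.
apply/eqP => ee; have := valP e; rewrite -/(efst e) -/(esnd e) ee.
by rewrite ltnn.
Qed.

Lemma edge_poisson e : poisson_process P (edge_rate e) (edge_process e).
Proof. by have [_ h _] := N_poisson; apply: h; exact: edge_neq. Qed.

(** Independence of the two edges makes the probability at most the product of
    the two means. *)
Lemma prob_two_jumps_le (e e' : edge S) a b : e != e' -> 0 <= a -> a <= b ->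
  outer_le P (jumps (edge_process e) a b `&` jumps (edge_process e') a b)
    (edge_rate e * edge_rate e' * (b - a) ^+ 2)%:E.
Proof.
move=> ee a0 ab; have b0 := le_trans a0 ab.
have [_ _ ind] := N_poisson.
exists (jumps (edge_process e) a b `&` jumps (edge_process e') a b).
split => //.
  by apply: measurableI; apply: (measurable_jumps (edge_poisson _)).
have := ind [fset e; e']%fset (fun i => jumps (edge_process i) a b).
rewrite set_fsetU !set_fset1 bigcap_setU !bigcap_set1 => ->; last first.
  by move=> i _; apply: sigma_jumps.
rewrite big_fsetU1/= ?inE// big_seq_fset1.
have h i := prob_jumps_le (edge_poisson i) a0 ab.
apply: le_trans (lee_pmul _ _ (h e) (h e')) _ => //.
by rewrite -EFinM lee_fin le_eqVlt; apply/orP; left; apply/eqP; ring.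
Qed.

End poisson_edges.

(** * Counting paths observed on a grid *)

Section counting_paths.
Context {R : realType}.

Lemma near_right_ex (x : R) (Q : R -> Prop) : (\forall y \near x^'+, Q y) ->
  exists2 z, x < z & forall y, x < y -> y < z -> Q y.
Proof.
move=> /nbhs_ballP[e /= e0 h]; exists (x + e); first by rewrite ltrDl.
by move=> y xy ye; apply: h => //; rewrite /ball/= ltr0_norm; lra.
Qed.

Lemma nat_close (a b : nat) : `|a%:R - b%:R : R| < 1 -> a = b.
Proof.
rewrite ltr_norml => /andP[h1 h2].
have h3 : (a < b.+1)%N by rewrite -(ltr_nat R) -(natr1 b); lra.
have h4 : (b < a.+1)%N by rewrite -(ltr_nat R) -(natr1 a); lra.
by apply/eqP; rewrite eqn_leq -ltnS h3 -ltnS h4.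
Qed.

Definition grid (p q : R) (m i : nat) : R := p + i%:R * (q - p) / m.+1%:R.

Lemma grid0 p q m : grid p q m 0 = p.
Proof. by rewrite /grid !mul0r addr0. Qed.

Lemma gridS p q m : grid p q m m.+1 = q.
Proof. by rewrite /grid mulrAC divff ?mul1r ?pnatr_eq0// addrC subrK. Qed.

Lemma grid_step p q m i : grid p q m i.+1 - grid p q m i = (q - p) / m.+1%:R.
Proof.
rewrite /grid; have -> : i.+1%:R = i%:R + 1 :> R by rewrite natr1.
set v := m.+1%:R^-1; ring.
Qed.

Lemma grid_le p q m i : p <= q -> grid p q m i <= grid p q m i.+1.
Proof. by move=> pq; rewrite -subr_ge0 grid_step divr_ge0// subr_ge0. Qed.

Lemma grid_ge p q m i : p <= q -> p <= grid p q m i.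
Proof.
by move=> pq; rewrite /grid lerDl divr_ge0// mulr_ge0// subr_ge0.
Qed.

Lemma grid_locate p q m t : p < t -> t <= q ->
  exists2 i, (i <= m)%N & grid p q m i < t <= grid p q m i.+1.
Proof.
move=> pt tq.
have : forall j, t <= grid p q m j ->
    exists2 i, (i < j)%N & grid p q m i < t <= grid p q m i.+1.
  elim=> [|j IH]; first by rewrite grid0 leNgt pt.
  move=> tj; have [tj'|tj'] := leP t (grid p q m j).
    by have [i ij h] := IH tj'; exists i => //; exact: ltnW.
  by exists j => //; rewrite tj' tj.
by move=> /(_ m.+1); rewrite gridS => /(_ tq).
Qed.

(** Being cut by some grid into increments 0 and 1, between any two rationals, is a
    condition on countably many values of the path, and it is enough to recover monotonicity and unit
    jumps for a càdlàg path. *)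
Definition tame (k : R -> nat) : Prop := forall p q : rat, 0 <= p -> p <= q ->
  exists m, forall i, (i <= m)%N ->
    let a := grid (ratr p) (ratr q) m i in
    let b := grid (ratr p) (ratr q) m i.+1 in
    k b = (k a + 0)%N \/ k b = (k a + 1)%N.

(** The analogous grid condition expressing that two paths have no common jump. *)
Definition separated (k k' : R -> nat) : Prop := forall n : nat,
  exists m, forall i, (i <= m)%N ->
    let a := grid 0 n%:R m i in let b := grid 0 n%:R m i.+1 in
    k b = k a \/ k' b = k' a.

Section one_path.
Variable k : R -> nat.
Hypothesis k_cadlag : cadlag k.

(** Convergence in the discrete space [nat] means being eventually equal. *)
Lemma near_right_eq t : 0 <= t -> \forall s \near t^'+, k s = k t.
Proof. by move=> t0; exact: (k_cadlag.1 t t0 _ (discrete_set1 (k t))). Qed.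

Lemma near_left_eq t : 0 < t -> exists l, \forall s \near t^'-, k s = l.
Proof.
move=> t0; have [l hl] := k_cadlag.2 t t0; exists l.
exact: (hl _ (discrete_set1 l)).
Qed.

(** Along a grid the path can only grow, so it is monotone on the rationals;
    right-continuity extends this to all times. *)
Lemma tame_le : tame k -> forall s t, 0 <= s -> s <= t -> (k s <= k t)%N.
Proof.
move=> tk; have le_rat (p q : rat) : 0 <= p -> p <= q ->
    (k (ratr p) <= k (ratr q))%N.
  move=> p0 pq; have [m hm] := tk p q p0 pq.
  have : forall i, (i <= m.+1)%N ->
      (k (ratr p) <= k (grid (ratr p) (ratr q) m i))%N.
    elim=> [|i IH] im; first by rewrite grid0.
    by apply: leq_trans (IH (ltnW im)) _; have [->|->] := hm i im; lia.
  by move=> /(_ m.+1 (leqnn _)); rewrite gridS.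
move=> s t s0; rewrite le_eqVlt => /predU1P[->//|st].
have t0 : 0 <= t by lra.
have [s1 ss1 hs] := near_right_ex (near_right_eq s0).
have [t1 tt1 ht] := near_right_ex (near_right_eq t0).
(* Rational times p in (s, t) and q > t at which the path has the same
   values as at s and t respectively. *)
have : s < Num.min s1 t by rewrite lt_min ss1 st.
move=> /rat_in_itvoo[p]; rewrite in_itv/= lt_min => /and3P[sp ps1 pt].
have [q] := rat_in_itvoo tt1; rewrite in_itv/= => /andP[tq qt1].
rewrite -(hs (ratr p))// -(ht (ratr q))//; apply: le_rat.
  by rewrite -(ler0q R); lra.
by rewrite -(ler_rat R); lra.
Qed.

Lemma near_left_ge0 (t : R) : 0 < t -> \forall s \near t^'-, 0 <= s.
Proof. exact: nbhs_left_ge. Qed.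

Definition near_const (t : R) : Prop := \forall s \near t^'-, k s = k t.

(** Two integers at distance less than 1 are equal, so a left limit equal to
    the value k t means that k is constant just before t. *)
Lemma jump_timeP t :
  jump_time (fun s => (k s)%:R : R) t <-> 0 < t /\ ~ near_const t.
Proof.
split=> -[t0 h]; split => // h'; apply: h.
  apply: cvg_near_cst; near=> s; congr (_ %:R); near: s; exact: h'.
have /cvgrPdist_lt/(_ 1 ltr01) := h'; apply: filterS => s /=.
by move=> h; apply/esym/nat_close.
Unshelve. all: end_near. Qed.

(** The cell of a fine grid that contains t bounds k(t) - k(t-) by 1. *)
Lemma tame_left_succ t : tame k -> 0 < t -> ~ near_const t ->
  \forall s \near t^'-, (k s).+1 = k t.
Proof.
move=> tk t0 njump.
have [l hl] := near_left_eq t0.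
have [n tn] : exists n : nat, t <= n%:R.
  by exists (Num.truncn t).+1; rewrite ltW// truncnS_gt.
have [m hm] := tk 0 n%:Q (lexx _) (ler0n _ n).
have [i im] := @grid_locate (ratr 0) (ratr n%:Q) m t
  ltac:(by rewrite rmorph0) ltac:(by rewrite ratr_nat).
set a := grid _ _ _ _; set b := grid _ _ _ _ => /andP[at_ tb].
have a0 : 0 <= a.
  have : ratr 0 <= a :> R by apply: grid_ge; rewrite rmorph0 ratr_nat.
  by rewrite rmorph0.
have kb : (k b <= k a + 1)%N.
  have hmi : k b = (k a + 0)%N \/ k b = (k a + 1)%N := hm i im.
  by case: hmi => ->; lia.
have lk : l.+1 = k t.
  have near1 : \forall s \near t^'-, [/\ k s = l, a < s & s < t].
    near=> s; split; near: s; [exact: hl|exact: nbhs_left_gt|exact: nbhs_left_lt].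
  have [s [ksl as_ st]] := @filter_ex _ _ (at_left_proper_filter t) _ near1.
  have h1 : (k a <= k s)%N by apply: tame_le => //; lra.
  have h2 : (k s <= k t)%N by apply: tame_le => //; lra.
  have h3 : (k t <= k b)%N by apply: tame_le => //; lra.
  have h4 : l <> k t by move=> lt; apply: njump; rewrite /near_const -lt.
  lia.
by near=> s; rewrite -lk; congr S; near: s.
Unshelve. all: end_near. Qed.

Lemma tame_unit_jumps : tame k -> unit_jumps (fun s => (k s)%:R : R).
Proof.
move=> tk t /jump_timeP[t0 /(tame_left_succ tk t0) h].
by apply: cvg_near_cst; move: h; apply: filterS => s <-; rewrite -natr1 addrK.
Qed.

End one_path.

(** In the cell of the grid that contains t, one of the two monotone paths has
    equal values at both ends, hence does not move. *)
Lemma separated_jumps (k k' : R -> nat) t :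
  cadlag k -> cadlag k' -> tame k -> tame k' -> separated k k' ->
  0 < t -> near_const k t \/ near_const k' t.
Proof.
move=> ck ck' tk tk' kk' t0.
have [n tn] : exists n : nat, t <= n%:R.
  by exists (Num.truncn t).+1; rewrite ltW// truncnS_gt.
have [m hm] := kk' n.
have [i im] := grid_locate m t0 tn.
set a := grid _ _ _ _; set b := grid _ _ _ _ => /andP[at_ tb].
have a0 : 0 <= a by apply: grid_ge.
have key (h : R -> nat) : cadlag h -> tame h -> h b = h a -> near_const h t.
  move=> ch th hab; near=> s.
  have as_ : a < s by near: s; exact: nbhs_left_gt.
  have st : s < t by near: s; exact: nbhs_left_lt.
  have h1 : (h a <= h s)%N by apply: tame_le => //; lra.
  have h2 : (h s <= h t)%N by apply: tame_le => //; lra.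
  have h3 : (h t <= h b)%N by apply: tame_le => //; lra.
  lia.
by have [e|e] := hm i im; [left|right]; apply: key.
Unshelve. all: end_near. Qed.

End counting_paths.

(** * Regular configurations *)

Section regular_configurations.
Context {R : realType} {S : countType}.
Implicit Types K : S -> S -> R -> nat.

Definition epath K (e : edge S) : R -> nat := K (efst e) (esnd e).

Lemma edge_ex (x y : S) : x != y ->
  exists e : edge S, (efst e = x /\ esnd e = y) \/ (efst e = y /\ esnd e = x).
Proof.
move=> xy; have := xy; rewrite -(inj_eq (pcan_inj (@choice.pickleK S))) neq_ltn.
case/orP => h.
  by exists (exist _ (x, y) h); left.
by exists (exist _ (y, x) h); right.
Qed.

(** A sufficient condition for [Gamma] which is countable, up to the càdlàg
    property, so that it can be checked almost surely. *)
Record regular K : Prop := Regular {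
  reg_sym : forall x y, K x y = K y x;
  reg_cadlag : forall e, cadlag (epath K e);
  reg_0 : forall e, epath K e 0 = 0%N;
  reg_tame : forall e, tame (epath K e);
  reg_separated : forall e e', e != e' -> separated (epath K e) (epath K e');
  reg_finite : forall x (n : nat),
    finite_set [set y | y != x /\ K x y n%:R <> 0%N] }.

Section regular_theory.
Variable K : S -> S -> R -> nat.
Hypothesis rK : regular K.

Lemma reg_epath x y : x != y ->
  exists e : edge S, K x y = epath K e /\
    ((efst e = x /\ esnd e = y) \/ (efst e = y /\ esnd e = x)).
Proof.
move=> /edge_ex[e h]; exists e; split => //.
by case: h => -[h1 h2]; rewrite /epath h1 h2// (reg_sym rK).
Qed.

Lemma reg_cadlagP x y : x != y -> cadlag (K x y).
Proof. by move=> /reg_epath[e [-> _]]; exact: reg_cadlag. Qed.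

Lemma reg_tameP x y : x != y -> tame (K x y).
Proof. by move=> /reg_epath[e [-> _]]; exact: reg_tame. Qed.

Lemma reg_le x y s t : x != y -> 0 <= s -> s <= t -> (K x y s <= K x y t)%N.
Proof. by move=> xy; apply: tame_le; [exact: reg_cadlagP|exact: reg_tameP]. Qed.

(** Up to a fixed time only finitely many neighbours contribute, since the
    paths are monotone: K_x is locally a finite sum of counting paths. *)
Lemma reg_sum x (n : nat) : exists2 Y : {fset S}, (forall y, y \in Y -> x != y) &
  forall t, 0 <= t -> t <= n%:R ->
    site_path_ereal K x t = ((\sum_(y <- Y) K x y t)%N%:R)%:E.
Proof.
have fin := reg_finite rK x n.
exists (fset_set [set y | y != x /\ K x y n%:R <> 0%N]).
  by move=> y; rewrite in_fset_set// inE/= => -[]; rewrite eq_sym.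
set Y := fset_set _ => t t0 tn; rewrite /site_path_ereal.
rewrite (esumID [set` Y]); last by move=> *; rewrite lee_fin.
rewrite [X in (_ + X)%E]esum1 ?adde0; last first.
  move=> y [/= yx yY]; rewrite /edge_path; apply/eqP; rewrite eqe pnatr_eq0 -leqn0.
  have -> : 0%N = K x y n%:R.
    apply/eqP; rewrite eq_sym; apply/negPn/negP => /eqP K0; apply: yY.
    by rewrite /Y /= in_fset_set// inE.
  by apply: reg_le => //; rewrite eq_sym.
rewrite natr_sum -fset_esum//; congr esum; apply/seteqP; split=> y /=.
  by case.
by rewrite /Y in_fset_set// inE => -[].
Qed.

Lemma sum_near (F : set_system R) {FF : Filter F} x (Y : {fset S}) (l : S -> nat) :
   (forall y, y \in Y -> \forall s \near F, K x y s = l y) ->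
   \forall s \near F, (\sum_(y <- Y) K x y s = \sum_(y <- Y) l y)%N.
Proof.
move=> h; have := @filter_bigI _ _ Y (fun y => [set s | K x y s = l y]) F FF h; apply: filterS => s hs.
by apply: eq_big_seq => y yY; exact: hs.
Qed.

Lemma reg_site_fin x t : 0 <= t -> (site_path_ereal K x t < +oo)%E.
Proof.
move=> t0; have [Y _ ->//] := reg_sum x (Num.truncn t).+1; first exact: ltry.
by rewrite ltW// truncnS_gt.
Qed.

Lemma reg_site_nat x (n : nat) : exists2 Y : {fset S}, (forall y, y \in Y -> x != y) &
  forall t, 0 <= t -> t <= n%:R ->
    site_path K x t = (\sum_(y <- Y) K x y t)%N%:R.
Proof.
have [Y Yx hY] := reg_sum x n; exists Y => // t t0 tn.
by rewrite /site_path hY.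
Qed.

Lemma reg_site_cadlag x : cadlag (site_path K x).
Proof.
split=> t t0.
  have [Y Yx hY] := reg_site_nat x (Num.truncn t).+1.
  have tn : t < (Num.truncn t).+1%:R by exact: truncnS_gt.
  rewrite hY//; last exact: ltW.
  apply: cvg_near_cst; near=> s.
  rewrite hY; last 2 first.
  - by apply: (le_trans t0); near: s; exact: nbhs_right_ge.
  - by near: s; exact: nbhs_right_ltW.
  congr (_ %:R); near: s; apply: sum_near => y yY.
    exact: (near_right_eq (reg_cadlagP (Yx y yY)) t0).
have [Y Yx hY] := reg_site_nat x (Num.truncn t).+1.
have tn : t < (Num.truncn t).+1%:R by exact: truncnS_gt.
have /choice[l hl] : forall y, exists l, y \in Y -> \forall s \near t^'-, K x y s = l.
  move=> y; have [yY|] := boolP (y \in Y); last by exists 0%N.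
  have [l hl] := near_left_eq (reg_cadlagP (Yx y yY)) t0.
  by exists l.
exists (\sum_(y <- Y) l y)%N%:R; apply: cvg_near_cst; near=> s.
have st : s < t by near: s; exact: nbhs_left_lt.
rewrite hY; last 2 first.
- by near: s; exact: near_left_ge0.
- by lra.
by congr (_ %:R); near: s; apply: sum_near.
Unshelve. all: end_near. Qed.

Lemma near_const_site x t : 0 < t ->
  (forall y, x != y -> near_const (K x y) t) ->
  ~ jump_time (site_path K x) t.
Proof.
move=> t0 h [_]; apply.
have [Y Yx hY] := reg_site_nat x (Num.truncn t).+1.
have tn : t < (Num.truncn t).+1%:R by exact: truncnS_gt.
rewrite hY ?ltW//; apply: cvg_near_cst; near=> s.
have st : s < t by near: s; exact: nbhs_left_lt.
rewrite hY; last 2 first.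
- by near: s; exact: near_left_ge0.
- by lra.
congr (_ %:R); near: s; apply: sum_near => y yY.
by apply: h; exact: Yx.
Unshelve. all: end_near. Qed.

Lemma reg_separatedP x y y' t : x != y -> x != y' -> y != y' -> 0 < t ->
  near_const (K x y) t \/ near_const (K x y') t.
Proof.
move=> xy xy' yy' t0.
have [e [Ke he]] := reg_epath xy; have [e' [Ke' he']] := reg_epath xy'.
rewrite Ke Ke'; apply: separated_jumps => //; try by [exact: reg_cadlag|exact: reg_tame].
apply: reg_separated => //; apply/eqP => ee'; subst e'.
case: he => -[h1 h2]; case: he' => -[h3 h4].
- by move: yy'; rewrite -h2 -h4 eqxx.
- by move: xy'; rewrite -h1 -h3 eqxx.
- by move: xy; rewrite -h3 -h1 eqxx.
- by move: yy'; rewrite -h1 -h3 eqxx.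
Qed.

(** At a jump time of K_x exactly one of the finitely many relevant edges jumps,
    because the edges have disjoint jump times, and it jumps by 1. *)
Lemma reg_site_unit_jumps x : unit_jumps (site_path K x).
Proof.
move=> t jt; have [t0 _] := jt.
have [y [xy njump]] : exists y, x != y /\ ~ near_const (K x y) t.
  apply: contrapT => h; apply: (@near_const_site x t) => // y xy.
  by apply: contrapT => hy; apply: h; exists y.
have [Y Yx hY] := reg_site_nat x (Num.truncn t).+1.
have tn : t < (Num.truncn t).+1%:R by exact: truncnS_gt.
have others y' : x != y' -> y' != y -> near_const (K x y') t.
  by move=> xy' yy'; have [] := reg_separatedP xy' xy yy' t0.
have succ := tame_left_succ (reg_cadlagP xy) (reg_tameP xy) t0 njump.
have yY : y \in Y.
  apply: contrapT => /negP yY; case: (jt) => _; apply.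
  rewrite hY ?ltW//; apply: cvg_near_cst; near=> s.
  have st : s < t by near: s; exact: nbhs_left_lt.
  rewrite hY; last 2 first.
  - by near: s; exact: near_left_ge0.
  - by lra.
  congr (_ %:R); near: s; apply: sum_near => y' y'Y.
  apply: others; first exact: Yx.
  by apply: contraNneq yY => <-.
rewrite hY ?ltW//; apply: cvg_near_cst; near=> s.
have st : s < t by near: s; exact: nbhs_left_lt.
rewrite hY; last 2 first.
- by near: s; exact: near_left_ge0.
- by lra.
suff -> : (\sum_(z <- Y) K x z t = (\sum_(z <- Y) K x z s).+1)%N.
  by rewrite -[in RHS]natr1 addrK.
rewrite (big_fsetD1 y)//= [in RHS](big_fsetD1 y)//= -addSn; congr addn.
  by apply/esym; near: s.
apply/esym; near: s; apply: sum_near => y'.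
by rewrite !inE => /andP[y'y y'Y]; apply: others => //; exact: Yx.
Unshelve. all: end_near. Qed.

Lemma regular_Gamma : Gamma K.
Proof.
split; split.
- exact: reg_sym.
- by move=> x y; exact: reg_cadlagP.
- move=> x; split.
  + by move=> t; exact: reg_site_fin.
  + exact: reg_site_cadlag.
  + exact: reg_site_unit_jumps.
- by move=> x y xy; apply: tame_unit_jumps; [exact: reg_cadlagP|exact: reg_tameP].
- move=> e e' ee' t [/(jump_timeP (epath K e))[t0 h] /(jump_timeP (epath K e'))[_ h']].
  have [] : near_const (epath K e) t \/ near_const (epath K e') t => //.
  by apply: separated_jumps => //; try by [exact: reg_cadlag|exact: reg_tame|exact: reg_separated].
- by move=> x y /reg_epath[e [-> _]]; exact: reg_0.
Qed.

End regular_theory.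
End regular_configurations.

(** * Almost sure regularity *)

Section regular_ae.
Context {R : realType} {S : countType} {d} {Om : measurableType d}.
Variables (P : probability Om R) (c : S -> S -> R).
Variable (N : S -> S -> R -> Om -> nat).
Hypothesis c_ge0 : forall x y, 0 <= c x y.
Hypothesis C1 : forall x, (site_rate_ereal c x < +oo)%E.
Hypothesis N_poisson : poisson_family P c N.

Definition config (w : Om) : S -> S -> R -> nat := fun x y s => N x y s w.

(** With m + 1 cells of probability O(1 / (m + 1) ^ 2) each, the m-th grid fails
    with probability O(1 / (m + 1)), so almost surely not all grids fail. *)
Lemma grid_negligible (B : nat -> nat -> set Om) (C : R) : 0 <= C ->
  (forall m i, (i <= m)%N -> outer_le P (B m i) (C / m.+1%:R ^+ 2)%:E) ->
  P.-negligible [set w | forall m, exists2 i, (i <= m)%N & B m i w].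
Proof.
move=> C0 hB; apply: outer_le_negligible => e e0.
have [m hm] : exists m : nat, C / m.+1%:R <= e.
  exists (Num.truncn (C / e)); rewrite ler_pdivrMr// mulrC -ler_pdivrMr//.
  by rewrite ltW// truncnS_gt.
apply: (@outer_le_sub _ _ _ P _ (\bigcup_(i in `I_m.+1) B m i)
    (\esum_(i in `I_m.+1) (C / m.+1%:R ^+ 2)%:E)).
- by move=> w /(_ m)[i im Bi]; exists i => //=; rewrite ltnS.
- rewrite esum_fset; [|exact: finite_II|]; last first.
    by move=> i _; rewrite lee_fin divr_ge0// exprn_ge0.
  rewrite -fsbig_ord sumEFin sumr_const card_ord lee_fin; apply: le_trans hm.
  rewrite -[leLHS]mulr_natl.
  rewrite le_eqVlt; apply/orP; left; apply/eqP.
  have : m.+1%:R != 0 :> R by rewrite pnatr_eq0.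
  by move: (m.+1%:R) => M M0; field.
- apply: outer_le_bigcup => i; first by rewrite lee_fin divr_ge0// exprn_ge0.
  by rewrite /= ltnS; exact: hB.
Qed.

Lemma tame_ae e : P.-negligible [set w | ~ tame (epath (config w) e)].
Proof.
have pe := edge_poisson N_poisson e.
pose a (pq : rat * rat) m i : R := grid (ratr pq.1) (ratr pq.2) m i.
pose B pq m i := ~` (incr (edge_process N e) (a pq m i) (a pq m i.+1) 0
   `|` incr (edge_process N e) (a pq m i) (a pq m i.+1) 1).
pose A (pq : rat * rat) := [set w | (0 <= pq.1) && (pq.1 <= pq.2) /\
   forall m, exists2 i, (i <= m)%N & B pq m i w].
apply: (@negligibleS _ _ _ _ (\bigcup_pq A pq)).
  move=> w /= ntame; apply: contrapT => nA; apply: ntame => p q p0 pq.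
  apply: contrapT => nm; apply: nA; exists (p, q) => //; split => /=.
    by rewrite p0 pq.
  move=> m; apply: contrapT => nB; apply: nm; exists m => i im /=.
  apply: contrapT => h; apply: nB; exists i => // -[h'|h']; apply: h.
apply: negligible_bigcup_count => -[p q].
have [/andP[p0 pq]|npq] := boolP ((0 <= p) && (p <= q)); last first.
  by apply: (negligibleS _ (negligible_set0 P)) => w [/=]; rewrite (negbTE npq).
apply: (@negligibleS _ _ _ _ [set w | forall m, exists2 i, (i <= m)%N & B (p, q) m i w]).
  by move=> w [].
have p0' : 0 <= ratr p :> R by rewrite ler0q.
have pq' : ratr p <= ratr q :> R by rewrite ler_rat.
apply: (@grid_negligible _ ((edge_rate c e * (ratr q - ratr p)) ^+ 2)).
  exact: sqr_ge0.
move=> m i im.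
have ai0 : 0 <= a (p, q) m i by apply: le_trans p0' _; exact: grid_ge.
apply: outer_le_sub (prob_multiple_jumps_le _ pe ai0 (grid_le m i pq')) => //.
  rewrite lee_fin grid_step mulrA expr_div_n//.
exact: c_ge0.
Qed.

Lemma separated_ae e e' : e != e' ->
  P.-negligible [set w | ~ separated (epath (config w) e) (epath (config w) e')].
Proof.
move=> ee'.
pose a n m i : R := grid 0 n%:R m i.
pose B n m i := jumps (edge_process N e) (a n m i) (a n m i.+1)
   `&` jumps (edge_process N e') (a n m i) (a n m i.+1).
pose A n := [set w | forall m, exists2 i, (i <= m)%N & B n m i w].
apply: (@negligibleS _ _ _ _ (\bigcup_n A n)).
  move=> w /= nsep; apply: contrapT => nA; apply: nsep => n.
  apply: contrapT => nm; apply: nA; exists n => // m.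
  apply: contrapT => nB; apply: nm; exists m => i im /=.
  apply: contrapT => h; apply: nB; exists i => //.
  by split => h'; apply: h; [left|right].
apply: negligible_bigcup_count => n.
have n0 : 0 <= n%:R :> R by [].
apply: (@grid_negligible _ (edge_rate c e * edge_rate c e' * n%:R ^+ 2)).
  by rewrite !mulr_ge0 ?c_ge0// sqr_ge0.
move=> m i im.
have ai0 : 0 <= a n m i by exact: grid_ge.
apply: outer_le_sub (prob_two_jumps_le N_poisson ee' ai0 (grid_le m i n0)) => //.
by rewrite lee_fin grid_step subr0 expr_div_n mulrA.
Qed.

(** The easy half of Borel-Cantelli: the site x has finite total rate, so the edges
    from x to the sites outside a large finite set are unlikely to ring at
    all up to time n. *)
Lemma finite_ae x (n : nat) :
  P.-negligible [set w | ~ finite_set [set y | y != x /\ config w x y n%:R <> 0%N]].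
Proof.
apply: outer_le_negligible => eps eps0.
have e0 : 0 < eps / n.+1%:R by rewrite divr_gt0.
have [F hF] := esum_small_tail (c_ge0 x) (C1 x) e0.
pose D := ~` [set` F] `&` [set y | y != x].
apply: (@outer_le_sub _ _ _ P _ (\bigcup_(y in D) jumps (N x y) 0 n%:R)
   (\esum_(y in D) (n%:R * c x y)%:E)).
- move=> w /= ninf; apply: contrapT => h; apply: ninf.
  apply: (@sub_finite_set _ _ [set` F]) => // y [yx hy].
  apply: contrapT => yF; apply: h; exists y => //.
  have [_ h _] := N_poisson; have xy : x != y by rewrite eq_sym.
  have [_ h0 _ _] := h x y xy.
  by rewrite /jumps/= h0.
- apply: (@le_trans _ _ (n%:R * (eps / n.+1%:R))%:E).
    apply: esumZ_le => //; apply: le_trans hF; apply: esum_subset.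
    exact: subIsetl.
  rewrite lee_fin mulrCA ger_pMr// ler_pdivrMr// mul1r ler_nat//.
- apply: outer_le_bigcup => y; first by rewrite lee_fin mulr_ge0.
  move=> [_ /= yx]; have xy : x != y by rewrite eq_sym.
  have [_ h _] := N_poisson; exists (jumps (N x y) 0 n%:R); split => //.
    exact: (measurable_jumps (h x y xy)).
  have := prob_jumps_le (h x y xy) (lexx 0) (ler0n R n).
  by rewrite subr0 mulrC.
Qed.

Lemma regular_ae : P.-negligible [set w | ~ regular (config w)].
Proof.
have n1 := negligible_bigcup_count tame_ae.
have n2 : P.-negligible (\bigcup_(ee : edge S * edge S)
   [set w | ee.1 != ee.2 /\ ~ separated (epath (config w) ee.1) (epath (config w) ee.2)]).
  apply: negligible_bigcup_count => -[e e'] /=.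
  have [->|ee'] := eqVneq e e'.
    by apply: (negligibleS _ (negligible_set0 P)) => w [/=].
  by apply: (negligibleS _ (separated_ae ee')) => w [].
have n3 := negligible_bigcup_count (fun xn : S * nat => finite_ae xn.1 xn.2).
apply: (negligibleS _ (negligibleU n1 (negligibleU n2 n3))) => w /= nreg.
apply: contrapT => h; apply: nreg; split.
- by move=> x y; have [sym _ _] := N_poisson; rewrite /config (sym x y).
- by move=> e; have [_ _ + _] := edge_poisson N_poisson e; apply.
- by move=> e; have [_ + _ _] := edge_poisson N_poisson e; apply.
- by move=> e; apply: contrapT => nt; apply: h; left; exists e.
- move=> e e' ee'; apply: contrapT => nt; apply: h; right; left.
  by exists (e, e').
- move=> x n; apply: contrapT => nt; apply: h; right; right.
  by exists (x, n).
Qed.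

End regular_ae.

(** * The backward algorithm with at most one jump *)

Section backward_algorithm.
Context {R : realType} {S : countType}.
Variable K : S -> S -> R -> nat.
Hypothesis rK : regular K.

(** Inversion of one step of the algorithm; [backward] being a relation, this is
    what proves that its output is unique. *)
Lemma backward_inv I x z : backward K I x z ->
  ((forall s, I s -> ~ jump_time (site_path K x) s) /\ z = x) \/
  exists t y, [/\ last_jump K x I t, y != x, jump_time (edge_path K x y) t &
    backward K `[0, t[%classic y z].
Proof. by case=> [{}I {}x h|{}I {}x t y {}z h1 h2 h3 h4]; [left|right; exists t, y]. Qed.

Lemma Xpos_unique t x z : backward K `[0, t]%classic x z ->
  (forall z', backward K `[0, t]%classic x z' -> z' = z) ->
  Xpos K t x = Some z.
Proof.
move=> bz uz; apply: xget_subset1.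
  by exists z => //; split => //; exact: regular_Gamma.
move=> _ _ [z1 [_ b1] <-] [z2 [_ b2] <-].
by rewrite (uz _ b1) (uz _ b2).
Qed.

Lemma no_site_jump x t s : (forall y, x != y -> K x y t = 0%N) -> s <= t ->
  ~ jump_time (site_path K x) s.
Proof.
move=> K0 st js; have [s0 _] := js.
have z y u : x != y -> 0 <= u -> u <= t -> K x y u = 0%N.
  move=> xy u0 ut; have := reg_le rK xy u0 ut.
  by rewrite (K0 y xy) leqn0 => /eqP.
apply: (near_const_site rK s0 _ js) => y xy; near=> u.
have us : u < s by near: u; exact: nbhs_left_lt.
have u0 : 0 <= u by near: u; exact: near_left_ge0.
by rewrite !z//; lra.
Unshelve. all: end_near. Qed.

Lemma Xpos_quiet x t : (forall y, x != y -> K x y t = 0%N) ->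
  Xpos K t x = Some x.
Proof.
move=> K0; have nj s : `[0, t]%classic s -> ~ jump_time (site_path K x) s.
  by rewrite /= in_itv/= => /andP[_ st]; exact: no_site_jump K0 st.
apply: Xpos_unique; first exact: backward_stop.
move=> z /backward_inv[[]//|[s [y [[Is js _] _ _ _]]]].
by have := nj s Is js.
Qed.

Lemma site_path_one x y u : x != y ->
  (forall z, x != z -> z != y -> K x z u = 0%N) ->
  site_path K x u = (K x y u)%:R.
Proof.
move=> xy K0; rewrite /site_path /site_path_ereal (esumID [set y]); last first.
  by move=> *; rewrite lee_fin.
rewrite [X in (_ + X)%E]esum1 ?adde0; last first.
  move=> z [/= zx /eqP zy]; rewrite /edge_path K0//.
  by rewrite eq_sym.
rewrite (_ : _ `&` _ = [set y]) ?esum_set1 ?lee_fin//.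
by apply/seteqP; split=> [z [] //|z -> /=]; split => //=; rewrite eq_sym.
Qed.

(** The jump time is the infimum of the times at which the path is positive. *)
Lemma first_jump (k : R -> nat) t : cadlag k -> tame k -> 0 <= t ->
  k 0 = 0%N -> k t = 1%N ->
  exists s, [/\ 0 < s, s <= t, k s = 1%N & forall u, 0 <= u -> u < s -> k u = 0%N].
Proof.
move=> ck tk t0 k0 kt.
pose J := [set u : R | 0 <= u /\ (0 < k u)%N].
have J0 : J t by split; rewrite // kt.
have Jlb : lbound J 0 by move=> u [].
have Jinf : has_inf J by split; [exists t|exists 0].
pose s := inf J.
have s0 : 0 <= s by apply: lb_le_inf => //; exists t.
have st : s <= t by apply: ge_inf => //; exists 0.
have below u : 0 <= u -> u < s -> k u = 0%N.
  move=> u0 us; apply/eqP; rewrite -leqn0 leqNgt; apply/negP => ku.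
  by have : s <= u by [apply: ge_inf => //; exists 0]; lra.
have ks0 : (0 < k s)%N.
  rewrite lt0n; apply/eqP => ks0.
  have [z sz hz] := near_right_ex (near_right_eq ck s0).
  suff : z <= s by lra.
  apply: lb_le_inf; first by exists t.
  move=> u [u0 ku]; rewrite leNgt; apply/negP => uz.
  have : k u = 0%N; last by move=> ku0; rewrite ku0 in ku.
  have [us|us|->//] := ltgtP u s; first exact: below.
  by rewrite hz.
have ks : k s = 1%N.
  by apply/eqP; rewrite eqn_leq ks0 -kt andbT; exact: tame_le.
exists s; split => //; rewrite lt_neqAle s0 andbT.
by apply/eqP => es; move: ks; rewrite -es k0.
Qed.

(** The site x sees the single ring of the edge {x, y}, at a time s, moves to y,
    and y is not touched during [0, s).  Quiet edges are only required to have
    value 0 at time t because paths are monotone. *)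
Lemma Xpos_jump x y t : 0 <= t -> x != y -> K x y t = 1%N ->
  (forall z, x != z -> z != y -> K x z t = 0%N) ->
  (forall z, y != z -> z != x -> K y z t = 0%N) ->
  Xpos K t x = Some y.
Proof.
move=> t0 xy Kt Kx Ky.
have ck := reg_cadlagP rK xy; have tk := reg_tameP rK xy.
have K00 : K x y 0 = 0%N by have [e [-> _]] := reg_epath rK xy; exact: reg_0.
have [s [s0 st Ks below]] := first_jump ck tk t0 K00 Kt.
have zero a b u : a != b -> K a b t = 0%N -> 0 <= u -> u <= t -> K a b u = 0%N.
  move=> ab Kab u0 ut; have := reg_le rK ab u0 ut.
  by rewrite Kab leqn0 => /eqP.
have site u : 0 <= u -> u <= t -> site_path K x u = (K x y u)%:R.
  move=> u0 ut; apply: site_path_one => // z xz zy.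
  by apply: zero => //; exact: Kx.
have jump_site u : 0 < u -> u <= t ->
    jump_time (site_path K x) u <-> ~ near_const (K x y) u.
  move=> u0 ut.
  have -> : jump_time (site_path K x) u <-> jump_time (fun v => (K x y v)%:R : R) u.
    have eqn : \forall v \near u^'-, site_path K x v = (K x y v)%:R :> R.
      near=> v; have vu : v < u by near: v; exact: nbhs_left_lt.
      apply: site; last by lra.
      by near: v; exact: near_left_ge0.
    rewrite /jump_time site//; last exact: ltW.
    have eqn' : \forall v \near u^'-, (K x y v)%:R = site_path K x v :> R.
      by move: eqn; apply: filterS => v ->.
    split=> -[_ h]; split => // h'; apply: h.
      exact: cvg_trans (near_eq_cvg eqn') h'.
    exact: cvg_trans (near_eq_cvg eqn) h'.
  by rewrite jump_timeP; split=> [[]|].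
have njs : ~ near_const (K x y) s.
  move=> h; have : \forall u \near s^'-, [/\ K x y u = K x y s, 0 <= u & u < s].
    near=> u; split; near: u; [exact: h|exact: near_left_ge0|exact: nbhs_left_lt].
  move=> /(@filter_ex _ _ (at_left_proper_filter s))[u [Kus u0 us]].
  by move: Kus; rewrite Ks below.
have js : jump_time (site_path K x) s by apply/jump_site.
have only u : 0 <= u -> u <= t -> jump_time (site_path K x) u -> u = s.
  move=> u0 ut ju; have [u0' _] := ju.
  have {ju} := (jump_site u u0' ut).1 ju.
  have [us|us|//] := ltgtP u s => -[]; near=> v.
    have vu : v < u by near: v; exact: nbhs_left_lt.
    have v0 : 0 <= v by near: v; exact: near_left_ge0.
    by rewrite !below//; lra.
  have vu : v < u by near: v; exact: nbhs_left_lt.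
  have vs : s < v by near: v; exact: nbhs_left_gt.
  have one r : s <= r -> r <= t -> K x y r = 1%N.
    move=> sr rt; apply/eqP; rewrite eqn_leq -{1}Kt -{1}Ks.
    by rewrite !tame_le//; lra.
  by rewrite !one//; lra.
have njy u : `[0, s[%classic u -> ~ jump_time (site_path K y) u.
  rewrite /= in_itv/= => /andP[u0 us] ju; have [u0' _] := ju.
  apply: (near_const_site rK u0' _ ju) => z yz; near=> v.
  have vu : v < u by near: v; exact: nbhs_left_lt.
  have v0 : 0 <= v by near: v; exact: near_left_ge0.
  have [->|zx] := eqVneq z x; first by rewrite reg_sym// !below//; lra.
  have Kyz := Ky z yz zx; have vt : v <= t by lra.
  have ut : u <= t by lra.
  by rewrite (zero y z v yz Kyz v0 vt) (zero y z u yz Kyz (ltW u0') ut).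
have ls : last_jump K x `[0, t]%classic s.
  split => //=; first by rewrite in_itv/= st ltW.
  by move=> u /=; rewrite in_itv/= => /andP[u0 ut] /only ->.
apply: Xpos_unique.
  have yx : y != x by rewrite eq_sym.
  have je : jump_time (edge_path K x y) s by apply/(jump_timeP (K x y)).
  by apply: (backward_step ls yx je); exact: backward_stop.
move=> z /backward_inv[[nj _]|[s' [y' [[/= Is' js' _] y'x je]]]].
  by case: ls => Is _ _; have [] := nj s Is js.
move: Is'; rewrite in_itv/= => /andP[s'0 s't].
have ss := only _ s'0 s't js'; subst s'.
have -> : y' = y.
  apply/eqP/negPn/negP => y'y; have [_] := (jump_timeP _ _).1 je; apply.
  near=> v; have vu : v < s by near: v; exact: nbhs_left_lt.
  have v0 : 0 <= v by near: v; exact: near_left_ge0.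
  have xy' : x != y' by rewrite eq_sym.
  have Kxy' := Kx y' xy' y'y; have vt : v <= t by lra.
  by rewrite (zero x y' v xy' Kxy' v0 vt) (zero x y' s xy' Kxy' s'0 st).
move=> /backward_inv[[_ //]|[s' [y'' [[Is' js'' _] _ _ _]]]].
by have := njy _ Is' js''.
Unshelve. all: end_near. Qed.

Definition touch (e : edge S) (x : S) : bool := (efst e == x) || (esnd e == x).

Lemma eta_quiet t x (sigma : conf S) : 
  (forall e, touch e x -> epath K e t = 0%N) -> eta K t sigma x = sigma x.
Proof.
move=> h; rewrite /eta Xpos_quiet// => y xy.
have [e [-> he]] := reg_epath rK xy; apply: h.
by case: he => -[h1 h2]; rewrite /touch h1 h2 eqxx ?orbT.
Qed.

Lemma eta_jump t x (e : edge S) (sigma : conf S) : 0 <= t ->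
  epath K e t = 1%N ->
  (forall e', e' != e -> [|| touch e' x, touch e' (efst e) | touch e' (esnd e)] ->
     epath K e' t = 0%N) ->
  eta K t sigma x = exchange sigma (efst e) (esnd e) x.
Proof.
move=> t0 Ke h; have ef := edge_neq e.
have other a b : a != b -> (a == efst e) && (b != esnd e) ||
      (a == esnd e) && (b != efst e) -> K a b t = 0%N.
  move=> ab hab; have [e' [-> he']] := reg_epath rK ab; apply: h; last first.
    case: he' => -[h1 h2]; rewrite /touch h1 h2.
      by case/orP: hab => /andP[/eqP -> _]; rewrite eqxx !orbT.
    by case/orP: hab => /andP[/eqP -> _]; rewrite eqxx !orbT.
  apply/eqP => ee; subst e'.
  case: he' => -[h1 h2]; move: hab ab ef; rewrite -h1 -h2 !eqxx.
    by rewrite andbF/= => /andP[/eqP ->]; rewrite eqxx.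
  by rewrite andbF orbF => /andP[/eqP ->]; rewrite eqxx.
rewrite /exchange; have [->|x1] := eqVneq x (efst e).
  rewrite /eta (@Xpos_jump _ (esnd e))//.
  - by move=> z ez zz; apply: other => //; rewrite eqxx zz.
  - by move=> z ez zz; apply: other => //; rewrite eqxx zz orbT.
have [->|x2] := eqVneq x (esnd e).
  rewrite /eta (@Xpos_jump _ (efst e))//; rewrite 1?eq_sym//.
  - by rewrite (reg_sym rK).
  - by move=> z ez zz; apply: other => //; rewrite eqxx zz orbT.
  - by move=> z ez zz; apply: other => //; rewrite eqxx zz.
apply: eta_quiet => e' te'; apply: h; last by rewrite te'.
apply/eqP => ee; move: te'; rewrite ee /touch => /orP[/eqP e1|/eqP e2].
  by rewrite e1 eqxx in x1.
by rewrite e2 eqxx in x2.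
Qed.

End backward_algorithm.

Section expectation_sandwich.
Context {R : realType} {d} {Om : measurableType d} (P : probability Om R).

(** The error is at most a on B and at most b on Q, so X lies between two finite
    combinations of indicators whose expectations differ by at most
    2 (a u + b v). *)
Lemma expectation_approx (X : Om -> R) (k : R) (s : seq (R * set Om))
    (B Q : set Om) (a b u v : R) :
  (forall i, i \in s -> measurable i.2) ->
  outer_le P B u%:E -> outer_le P Q v%:E -> 0 <= a -> 0 <= b ->
  (forall w, ~ B w -> ~ Q w -> X w = k + \sum_(i <- s) i.1 * \1_(i.2) w) ->
  (forall w, ~ Q w -> `|X w - (k + \sum_(i <- s) i.1 * \1_(i.2) w)| <= a) ->
  (forall w, `|X w - (k + \sum_(i <- s) i.1 * \1_(i.2) w)| <= b) ->
  `|fine 'E_P[X] - (k + \sum_(i <- s) i.1 * fine (P i.2))| <= a * u + b * v.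
Proof.
move=> ms [B' [mB BB PB]] [Q' [mQ QQ PQ]] a0 b0 hexact hB hQ.
pose h w := k + \sum_(i <- s) i.1 * \1_(i.2) w.
(* The lower and upper bounds are the cases z = -1 and z = 1. *)
pose t (z : R) := [:: (k, setT), (z * a, B'), (z * b, Q') & s] : seq (R * set Om).
have mt z i : i \in t z -> measurable i.2.
  rewrite !in_cons => /or4P[/eqP->|/eqP->|/eqP->|/ms//].
  - exact: measurableT.
  - exact: mB.
  - exact: mQ.
have Et z : fine 'E_P[fun w => (\sum_(i <- t z) i.1 * \1_(i.2) w)%R] =
   k + \sum_(i <- s) i.1 * fine (P i.2) + z * (a * fine (P B') + b * fine (P Q')).
  rewrite expectation_simple; last exact: mt.
  by rewrite /= !big_cons /= probability_setT /=; ring.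
have tE z w : \sum_(i <- t z) i.1 * \1_(i.2) w = h w + z * (a * \1_B' w + b * \1_Q' w).
  by rewrite !big_cons /= indicT /h /=; ring.
have close w : `|X w - h w| <= a * \1_B' w + b * \1_Q' w.
  have [Qw|nQ] := pselect (Q w).
    have -> : \1_Q' w = 1 :> R by rewrite indicE mem_set//; exact: QQ.
    by rewrite mulr1 (le_trans (hQ w))// lerDr mulr_ge0.
  have [Bw|nB] := pselect (B w).
    have -> : \1_B' w = 1 :> R by rewrite indicE mem_set//; exact: BB.
    by rewrite mulr1 (le_trans (hB w nQ))// lerDl mulr_ge0.
  by rewrite hexact// subrr normr0 addr_ge0// mulr_ge0.
have fin z : ('E_P[fun w => (\sum_(i <- t z) i.1 * \1_(i.2) w)%R])%E \is a fin_num.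
  by rewrite expectation_simple//; exact: mt.
have le1 : ('E_P[fun w => (\sum_(i <- t (-1)) i.1 * \1_(i.2) w)%R] <= 'E_P[X])%E.
  apply: expectation_mono => w; rewrite tE.
  by have := close w; rewrite ler_norml => /andP[h1 h2]; lra.
have le2 : ('E_P[X] <= 'E_P[fun w => (\sum_(i <- t 1%R) i.1 * \1_(i.2) w)%R])%E.
  apply: expectation_mono => w; rewrite tE.
  by have := close w; rewrite ler_norml => /andP[h1 h2]; lra.
have finX : ('E_P[X])%E \is a fin_num.
  apply/fin_real/andP; split.
    by apply: lt_le_trans le1; rewrite ltNye_eq fin.
  by apply: le_lt_trans le2 _; rewrite ltey_eq fin.
have pb : fine (P B') <= u by rewrite -lee_fin fineK// fin_num_measure.
have pq : fine (P Q') <= v by rewrite -lee_fin fineK// fin_num_measure.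
have apb : a * fine (P B') <= a * u by exact: ler_wpM2l.
have bpq : b * fine (P Q') <= b * v by exact: ler_wpM2l.
have := fine_le (fin (-1)) finX le1; have := fine_le finX (fin 1) le2.
rewrite !Et ler_norml => h1 h2; apply/andP; split; lra.
Qed.

End expectation_sandwich.

(** * Local functions *)

Section local_functions.
Context {R : realType} {S : countType}.
Implicit Types (A : {fset S}) (f g : conf S -> R).

Definition local_on A f := forall eta zeta : conf S,
  (forall x, x \in A -> eta x = zeta x) -> f eta = f zeta.

Lemma local_onP f : local_fun f -> exists A, local_on A f.
Proof.
move=> [A finA h]; exists (fset_set A) => eta zeta e; apply: h => x Ax.
by apply: e; rewrite in_fset_set// inE.
Qed.

(** f takes only the values at the configurations supported in A, one for
    each subset of A. *)
Lemma local_on_bounded A f : local_on A f ->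
  exists2 M, 0 <= M & forall eta, `|f eta| <= M.
Proof.
move=> lf; (* The restriction of eta to A is the indicator of a subset of A. *)
pose ind (B : {fset S}) : conf S := fun x => x \in B.
exists (\sum_(B <- fpowerset A) `|f (ind B)|); first exact: sumr_ge0.
move=> eta; pose B := [fset x in A | eta x]%fset.
have -> : f eta = f (ind B).
  by apply: lf => x xA; rewrite /ind /B !inE/= xA.
rewrite (big_fsetD1 B)/=; last by rewrite fpowersetE; exact: fset_sub.
by rewrite lerDl sumr_ge0.
Qed.

(** Agreeing with eta on the finite set A is an open condition in the product
    topology, and f is constant on it. *)
Lemma local_on_continuous A f : local_on A f -> continuous f.
Proof.
move=> lf eta.
suff near_eta : \forall zeta \near eta, forall x, x \in A -> eta x = zeta x.
  apply: cvg_near_cst; move: near_eta; apply: filterS => zeta.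
  by move=> /lf.
apply: (@filter_bigI _ _ A (fun x => [set zeta : conf S | eta x = zeta x]) (nbhs eta)) => x _.
have := @proj_continuous S (fun _ => bool) x eta.
move=> /(_ [set eta x] (discrete_set1 _)).
by apply: filterS => zeta /= ->.
Qed.

End local_functions.

(** * The series defining the generator *)

Section generator_series.
Context {R : realType} {S : countType}.
Variable c : S -> S -> R.
Hypothesis c_ge0 : forall x y, 0 <= c x y.
Hypothesis c_sym : forall x y, c x y = c y x.
Hypothesis c_diag : forall x, c x x = 0.
Hypothesis C1 : forall x, (site_rate_ereal c x < +oo)%E.

Definition meets (A : {fset S}) (e : edge S) : bool :=
  (efst e \in A) || (esnd e \in A).

Lemma touch_meets A e x : x \in A -> touch e x -> meets A e.
Proof. by move=> xA; rewrite /meets => /orP[/eqP->|/eqP->]; rewrite xA ?orbT. Qed.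

Definition meet_rate (A : {fset S}) (e : edge S) : R :=
  (meets A e)%:R * edge_rate c e.

Lemma meet_rate_ge0 A e : 0 <= meet_rate A e.
Proof. by rewrite mulr_ge0// /edge_rate c_ge0. Qed.

Lemma pair_rate_fin (A : {fset S}) :
  (\esum_(p in [set: S * S]) ((p.1 \in A)%:R * c p.1 p.2)%:E < +oo)%E.
Proof.
have -> : [set: S * S] = [set: S] `*`` (fun=> [set: S]) by apply/seteqP.
rewrite -(esum_esum (a := fun x y => ((x \in A)%:R * c x y)%:E)); last first.
  by move=> x y _ _; rewrite lee_fin mulr_ge0.
rewrite (esumID [set` A]); last first.
  by move=> x _; apply: esum_ge0 => y _; rewrite lee_fin mulr_ge0.
rewrite [X in (_ + X)%E]esum1 ?adde0; last first.
  move=> x [_ /= /negP xA]; rewrite esum1// => y _.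
  by rewrite (negbTE xA) mul0r.
rewrite setTI esum_fset//; last first.
  by move=> x _; apply: esum_ge0 => y _; rewrite lee_fin mulr_ge0.
rewrite fsbig_finite//=; apply: lte_sum_pinfty => x _.
apply: le_lt_trans (C1 x); apply: le_esum => y _; rewrite lee_fin.
by case: (_ \in _); rewrite ?mul1r ?mul0r.
Qed.

(** Each edge meeting A, suitably oriented, is an ordered pair that starts in A,
    and the total rate of these pairs is the sum of the site rates over A. *)
Lemma meet_rate_fin (A : {fset S}) :
  (\esum_(e in [set: edge S]) (meet_rate A e)%:E < +oo)%E.
Proof.
apply: le_lt_trans (pair_rate_fin A).
rewrite (esum_pairs_edges (g := fun p => (p.1 \in A)%:R * c p.1 p.2)); last 2 first.
- by move=> p; rewrite mulr_ge0.
- by move=> x /=; rewrite c_diag mulr0.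
apply: le_esum => e _; rewrite lee_fin /= (c_sym (esnd e)) -mulrDl.
rewrite /meet_rate ler_wpM2r//; first exact: c_ge0.
by rewrite /meets; do 2 case: (_ \in _); rewrite /= ?addr0 ?add0r// lerDl.
Qed.

Definition pair_rate (A : {fset S}) (p : S * S) : R :=
  ((p.1 \in A) || (p.2 \in A))%:R * c p.1 p.2.

Lemma pair_rate_ge0 A p : 0 <= pair_rate A p.
Proof. by rewrite mulr_ge0. Qed.

Lemma meet_pair_rate_fin (A : {fset S}) :
  (\esum_(p in [set: S * S]) (pair_rate A p)%:E < +oo)%E.
Proof.
rewrite esum_pairs_edges; last 2 first.
- exact: pair_rate_ge0.
- by move=> x; rewrite /pair_rate c_diag mulr0.
under eq_esum => e _.
  rewrite /pair_rate /= (c_sym (esnd e)) [(esnd e \in A) || _]orbC EFinD.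
  over.
have ge0 i : [set: edge S] i -> (0 <= (meet_rate A i)%:E)%E.
  by move=> _; rewrite lee_fin meet_rate_ge0.
by rewrite esumD//= lte_add_pinfty//; exact: meet_rate_fin.
Qed.

Section one_function.
Variables (A : {fset S}) (f : conf S -> R) (M : R).
Hypothesis M_ge0 : 0 <= M.
Hypothesis f_bound : forall eta, `|f eta| <= M.
Hypothesis f_local : local_on A f.

Definition exchange_diff (x y : S) (eta : conf S) : R := f (exchange eta x y) - f eta.

Lemma exchange_diff_bound x y eta : `|exchange_diff x y eta| <= 2 * M.
Proof.
rewrite (le_trans (ler_normB _ _))//.
by have := f_bound eta; have := f_bound (exchange eta x y); lra.
Qed.

(** Only the edges meeting A contribute to the generator series, and their total
    rate is finite; this is why the series converges. *)
Lemma exchange_diff0 x y eta : x \notin A -> y \notin A -> exchange_diff x y eta = 0.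
Proof.
move=> xA yA; rewrite /exchange_diff; apply/eqP; rewrite subr_eq0; apply/eqP.
apply: f_local => z zA; rewrite /exchange.
case: eqVneq => [zx|_]; first by rewrite -zx zA in xA.
by case: eqVneq => [zy|//]; rewrite -zy zA in yA.
Qed.

Lemma exchange_sym (eta : conf S) x y : exchange eta x y = exchange eta y x.
Proof.
apply/funext => z; rewrite /exchange; case: (eqVneq z x) => [->|//].
by case: eqVneq => [->|//].
Qed.

Lemma exchange_same (eta : conf S) x y : eta x = eta y -> exchange eta x y = eta.
Proof.
move=> e; apply/funext => z; rewrite /exchange.
by case: eqVneq => [->|_]; [rewrite e|case: eqVneq => [->|]].
Qed.

Lemma local_exchange_diff x y : local_on (A `|` [fset x; y])%fset (exchange_diff x y).
Proof.
move=> eta zeta e; rewrite /exchange_diff.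
rewrite (f_local (_ : forall z, z \in A -> eta z = zeta z)); last first.
  by move=> z zA; apply: e; rewrite !inE zA.
congr (_ - _); apply: f_local => z zA; rewrite /exchange.
by rewrite !e// !inE ?eqxx ?orbT// zA.
Qed.

Definition gen_term (e : edge S) (eta : conf S) : R :=
  c (efst e) (esnd e) * (f (exchange eta (efst e) (esnd e)) - f eta).

Definition gen_pair (p : S * S) (eta : conf S) : R :=
  c p.1 p.2 * (eta p.1)%:R * (1 - (eta p.2)%:R)
          * (f (exchange eta p.1 p.2) - f eta).

Lemma gen_term_bound e eta : `|gen_term e eta| <= 2 * M * meet_rate A e.
Proof.
rewrite /gen_term -/(exchange_diff _ _ _) normrM ger0_norm// /meet_rate /edge_rate /meets.
have := exchange_diff_bound (efst e) (esnd e) eta.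
have [h|/norP[h1 h2]] := boolP (_ || _) => b.
  by rewrite mul1r mulrC ler_wpM2r.
by rewrite exchange_diff0// normr0 mulr0 mul0r mulr0.
Qed.

Lemma gen_pair_bound p eta : `|gen_pair p eta| <= 2 * M * pair_rate A p.
Proof.
rewrite /gen_pair -/(exchange_diff _ _ _) !normrM (ger0_norm (c_ge0 _ _)) /pair_rate.
have := exchange_diff_bound p.1 p.2 eta.
have [h|/norP[h1 h2]] := boolP (_ || _) => b; last first.
  by rewrite exchange_diff0// normr0 mulr0 mul0r mulr0.
rewrite mul1r [leRHS]mulrC ler_pM ?mulr_ge0//.
rewrite -mulrA ler_piMr// /nat_of_bool.
by case: (eta p.1); case: (eta p.2); rewrite ?subr0 ?subrr ?normr1 ?normr0 ?mulr0 ?mul0r ?mulr1.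
Qed.

Lemma esum_scaled_fin (I : choiceType) (r : I -> R) : (forall i, 0 <= r i) ->
  (\esum_(i in [set: I]) (r i)%:E < +oo)%E ->
  (\esum_(i in [set: I]) (2 * M * r i)%:E < +oo)%E.
Proof.
move=> r0 rfin.
have rf : \esum_(i in [set: I]) (r i)%:E \is a fin_num.
  by rewrite ge0_fin_numE// esum_ge0// => i _; rewrite lee_fin.
apply: le_lt_trans (ltry (2 * M * fine (\esum_(i in [set: I]) (r i)%:E))).
by apply: esumZ_le; [rewrite mulr_ge0|rewrite fineK].
Qed.

Lemma abs_convergent (I : choiceType) (F : I -> conf S -> R) (r : I -> R) :
  (forall i, continuous (F i)) -> (forall i eta, `|F i eta| <= 2 * M * r i) ->
  (\esum_(i in [set: I]) (r i)%:E < +oo)%E -> (forall i, 0 <= r i) ->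
  abs_convergent_in_C F.
Proof.
move=> cF Fr rfin r0; split => //.
apply: (@le_lt_trans _ _ (\esum_(i in [set: I]) (2 * M * r i)%:E)%E).
  apply: le_esum => i _; apply: ge_ereal_sup => _ [eta _ <-].
  by rewrite lee_fin.
exact: esum_scaled_fin.
Qed.

Lemma gen_term_continuous e : continuous (gen_term e).
Proof.
apply: (@local_on_continuous _ _ (A `|` [fset efst e; esnd e])%fset).
by move=> eta zeta h; rewrite /gen_term -!/(exchange_diff _ _ _) (local_exchange_diff h).
Qed.

Lemma gen_pair_continuous p : continuous (gen_pair p).
Proof.
apply: (@local_on_continuous _ _ (A `|` [fset p.1; p.2])%fset).
move=> eta zeta h; rewrite /gen_pair -!/(exchange_diff _ _ _) (local_exchange_diff h).
by rewrite !h// !inE eqxx ?orbT.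
Qed.

Lemma gen_term_abs_convergent : abs_convergent_in_C gen_term.
Proof.
apply: (abs_convergent gen_term_continuous gen_term_bound (meet_rate_fin A)).
exact: meet_rate_ge0.
Qed.

Lemma gen_pair_abs_convergent : abs_convergent_in_C gen_pair.
Proof.
apply: (abs_convergent gen_pair_continuous gen_pair_bound (meet_pair_rate_fin A)).
exact: pair_rate_ge0.
Qed.

Definition generator_series (eta : conf S) : R := family_sum (fun e => gen_term e eta).

(** For a fixed edge the two ordered terms have coefficients eta(x)(1 - eta(y))
    and eta(y)(1 - eta(x)); at most one is 1, and if none is then
    eta(x) = eta(y) and the exchange difference vanishes. *)
Lemma generator_series_pairs eta : generator_series eta =
  family_sum (fun x => family_sum (fun y => gen_pair (x, y) eta)).
Proof.
rewrite (family_sum2 (u := fun p => gen_pair p eta) (r := fun p => 2 * M * pair_rate A p)); last 2 first.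
- by move=> p; exact: gen_pair_bound.
- by apply: esum_scaled_fin; [exact: pair_rate_ge0|exact: meet_pair_rate_fin].
rewrite /generator_series (family_sum_posneg (r := fun e => 2 * M * meet_rate A e)); last 2 first.
- by move=> e; exact: gen_term_bound.
- by apply: esum_scaled_fin; [exact: meet_rate_ge0|exact: meet_rate_fin].
have diag s x : pos_part (s * gen_pair (x, x) eta) = 0.
  by rewrite /gen_pair /= c_diag !mul0r mulr0 /pos_part maxxx.
(* The sign s is 1 for the positive parts and -1 for the negative parts. *)
have edgeE s e : pos_part (s * gen_pair (efst e, esnd e) eta)
     + pos_part (s * gen_pair (esnd e, efst e) eta) = pos_part (s * gen_term e eta).
  rewrite /gen_pair /gen_term /= (exchange_sym _ (esnd e)) (c_sym (esnd e)).
  set D := f _ - f _; set k := c _ _; set a := eta (efst e); set b := eta (esnd e).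
  case: (boolP a) => ha; case: (boolP b) => hb;
    rewrite ?subrr ?subr0 ?mulr0 ?mul0r ?mulr1 ?mulr0 ?mul0r; rewrite ?mulr0 /pos_part ?maxxx ?addr0 ?add0r//.
    have -> : D = 0; last by rewrite !mulr0 maxxx.
    by rewrite /D exchange_same ?subrr//; rewrite -/a -/b; rewrite ha hb.
  have -> : D = 0; last by rewrite !mulr0 maxxx.
  by rewrite /D exchange_same ?subrr//; rewrite -/a -/b; rewrite (negbTE ha) (negbTE hb).
congr (fine _ - fine _).
  rewrite (esum_pairs_edges (g := fun p => pos_part (gen_pair p eta))); last 2 first.
  - by move=> p; exact: pos_part_ge0.
  - by move=> x; rewrite -(mul1r (gen_pair _ _)) diag.
  by apply: eq_esum => e _; have := edgeE 1 e; rewrite !mul1r => ->.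
rewrite (esum_pairs_edges (g := fun p => pos_part (- gen_pair p eta))); last 2 first.
- by move=> p; exact: pos_part_ge0.
- by move=> x; rewrite -(mulN1r (gen_pair _ _)) diag.
by apply: eq_esum => e _; have := edgeE (-1) e; rewrite !mulN1r => ->.
Qed.

Lemma generator_series_approx (eps : R) : 0 < eps -> exists F : {fset edge S},
  (\esum_(e in ~` [set` F]) (meet_rate A e)%:E <= eps%:E)%E /\
  forall eta, `|generator_series eta - \sum_(e <- F) gen_term e eta| <= 2 * M * eps.
Proof.
move=> eps0.
have [F hF] := esum_small_tail (meet_rate_ge0 A) (meet_rate_fin A) eps0.
exists F; split => // eta.
apply: (family_sum_tail (r := fun e => 2 * M * meet_rate A e)).
- by move=> e; exact: gen_term_bound.
- by apply: esum_scaled_fin; [exact: meet_rate_ge0|exact: meet_rate_fin].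
- by apply: esumZ_le => //; rewrite mulr_ge0.
Qed.

(** A uniform limit of finite sums, each of which is local. *)
Lemma generator_series_continuous : continuous generator_series.
Proof.
move=> eta; apply/cvgrPdist_lt => eps eps0.
have M0 := M_ge0.
have e0 : 0 < eps / (4 * (2 * M + 1)).
  rewrite divr_gt0//; lra.
have [F [_ hF]] := generator_series_approx e0.
have hs : 2 * M * (eps / (4 * (2 * M + 1))) <= eps / 4.
  have : eps / (4 * (2 * M + 1)) * (4 * (2 * M + 1)) = eps by rewrite divfK//; lra.
  by move: e0; move: (eps / (4 * (2 * M + 1))) => k k0 kE; lra.
have cF : (fun zeta => \sum_(e <- F) gen_term e zeta) zeta @[zeta --> eta]
    --> \sum_(e <- F) gen_term e eta.
  by apply: cvg_big => [|e _]; [exact: add_continuous|exact: gen_term_continuous].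
have e4 : 0 < eps / 4 by rewrite divr_gt0.
have /cvgrPdist_lt/(_ _ e4) := cF; apply: filterS => zeta.
have := hF eta; have := hF zeta.
by rewrite !ltr_norml !ler_norml => /andP[? ?] /andP[? ?] /andP[? ?]; apply/andP; split; lra.
Qed.

End one_function.
End generator_series.

(** * Short-time expansion of the semigroup *)

Section generator_estimate.
Context {R : realType} {S : countType} {d} {Om : measurableType d}.
Variables (P : probability Om R) (c : S -> S -> R).
Variable (N : S -> S -> R -> Om -> nat).
Hypothesis c_ge0 : forall x y, 0 <= c x y.
Hypothesis c_sym : forall x y, c x y = c y x.
Hypothesis c_diag : forall x, c x x = 0.
Hypothesis C1 : forall x, (site_rate_ereal c x < +oo)%E.
Hypothesis N_poisson : poisson_family P c N.
Variables (A : {fset S}) (f : conf S -> R) (M : R).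
Hypothesis M_ge0 : 0 <= M.
Hypothesis f_bound : forall eta, `|f eta| <= M.
Hypothesis f_local : local_on A f.

Notation jump t e := (jumps (edge_process N e) 0 t).
Notation jump1 t e := (incr (edge_process N e) 0 t 1).
Notation D e sigma := (exchange_diff f (efst e) (esnd e) sigma).

Definition neighbourhood (e : edge S) : {fset S} := (A `|` [fset efst e; esnd e])%fset.

Definition far_jump (F : {fset edge S}) t : set Om :=
  \bigcup_(e in ~` [set` F]) [set w | meets A e /\ jump t e w].

Definition multiple_jump (F : {fset edge S}) t : set Om :=
  \bigcup_(e in [set` F]) ~` (incr (edge_process N e) 0 t 0 `|` jump1 t e).

Definition two_jumps (F : {fset edge S}) t : set Om :=
  \bigcup_(e in [set` F]) \bigcup_(e' in [set: edge S])
    [set w | [/\ e' != e, meets (neighbourhood e) e', jump t e w & jump t e' w]].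

Definition irregular : set Om := [set w | ~ regular (config N w)].

Lemma jump_epath t e w : ~ irregular w ->
  jump t e w <-> epath (config N w) e t <> 0%N.
Proof.
move=> /contrapT rw; have h0 : edge_process N e 0 w = 0%N := reg_0 rw e.
by rewrite /jumps /= h0.
Qed.

(** Exact when at most one edge near A rings, only once, and belongs to F; its
    expectation is explicit to first order in t. *)
Definition linearization (F : {fset edge S}) t sigma w : R :=
  f sigma + \sum_(e <- F) D e sigma * \1_(jump1 t e) w.

Lemma term_quiet t sigma w e :
  (meets A e -> ~ jump t e w) -> D e sigma * \1_(jump1 t e) w = 0.
Proof.
move=> nj; have [mA|] := boolP (meets A e); last first.
  by rewrite negb_or => /andP[h1 h2]; rewrite (exchange_diff0 f_local) ?mul0r.
rewrite indicE memNset ?mulr0// => j1; apply: (nj mA); rewrite /jumps /=.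
by move: j1; rewrite /incr/= => ->; lia.
Qed.

(** An edge of F meeting A that also rang would form, with the far edge, a pair
    of close edges that both ring.  Hence every term of the sum vanishes, and the
    error on this event is 2 M however large F is. *)
Lemma linearization_far F t sigma w : ~ irregular w -> ~ two_jumps F t w ->
  far_jump F t w -> linearization F t sigma w = f sigma.
Proof.
move=> rw n2 [e0 /= e0F [me0 je0]].
rewrite /linearization big_seq big1 ?addr0// => e eF.
apply: term_quiet => mA je; apply: n2; exists e => //; exists e0 => //.
split => //; first by apply/eqP => ee; apply: e0F; rewrite ee.
by move: me0; rewrite /meets /neighbourhood !inE => /orP[->|->]; rewrite ?orbT.
Qed.

Lemma linearization_exact F t sigma w : 0 <= t ->
  ~ irregular w -> ~ two_jumps F t w -> ~ multiple_jump F t w -> ~ far_jump F t w ->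
  f (eta (config N w) t sigma) = linearization F t sigma w.
Proof.
move=> t0 rw n2 nm nf; have /contrapT reg := rw.
have [[e [eF mA je]]|none] := pselect (exists e, [/\ e \in F, meets A e & jump t e w]).
  have j1 : jump1 t e w.
    apply: contrapT => nj; apply: nm; exists e => //= -[j0|//].
    by apply: je; rewrite j0 addn0.
  have Ke : epath (config N w) e t = 1%N.
    move: j1; have h0 : edge_process N e 0 w = 0%N := reg_0 reg e.
    by rewrite /incr /= h0.
  have others e' : e' != e -> meets (neighbourhood e) e' -> ~ jump t e' w.
    by move=> ee' me' je'; apply: n2; exists e => //; exists e'.
  rewrite /linearization (big_fsetD1 e)//= indicE mem_set// mulr1.
  rewrite big_seq big1 ?addr0; last first.
    move=> e'; rewrite !inE => /andP[ee' e'F]; apply: term_quiet => mA'.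
    apply: others => //.
    by move: mA'; rewrite /meets /neighbourhood !inE => /orP[->|->]; rewrite ?orbT.
  rewrite /exchange_diff addrC subrK; apply: f_local => x xA.
  apply: eta_jump => // e' ee' te'; apply: contrapT => h.
  apply: (others e' ee'); last exact/jump_epath.
  case/or3P: te'; apply: touch_meets; rewrite !inE ?eqxx ?orbT// xA.
  by [].
have quiet e : meets A e -> ~ jump t e w.
  move=> mA je; have [eF|eF] := boolP (e \in F); first by apply: none; exists e.
  by apply: nf; exists e => //=; apply/negP.
rewrite /linearization big_seq big1 ?addr0; last first.
  by move=> e eF; apply: term_quiet; exact: quiet.
apply: f_local => x xA; apply: eta_quiet => // e te; apply: contrapT => h.
by apply: (quiet e (touch_meets xA te)); exact/jump_epath.
Qed.

Lemma far_jump_le F t eps : 0 <= t ->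
  (\esum_(e in ~` [set` F]) (meet_rate c A e)%:E <= eps%:E)%E ->
  outer_le P (far_jump F t) (t * eps)%:E.
Proof.
move=> t0 hF.
apply: (@outer_le_sub _ _ _ P _ _ _ _ (@subset_refl _ _) (esumZ_le t0 hF)).
apply: outer_le_bigcup => e; first by rewrite lee_fin mulr_ge0// meet_rate_ge0.
move=> _; rewrite /meet_rate; case: (boolP (meets A e)) => mA; last first.
  exists set0; split => //; first by move=> w [].
  by rewrite measure0 mul0r mulr0.
exists (jump t e); split; first exact: (measurable_jumps (edge_poisson N_poisson e)).
  by move=> w [].
have := prob_jumps_le (edge_poisson N_poisson e) (lexx 0) t0.
by rewrite subr0 mul1r mulrC.
Qed.

Lemma multiple_jump_le F t : 0 <= t ->
  outer_le P (multiple_jump F t) (\sum_(e <- F) (edge_rate c e * t) ^+ 2)%:E.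
Proof.
move=> t0; rewrite -fset_esum; last by move=> e; exact: sqr_ge0.
apply: outer_le_bigcup => e _; first by rewrite lee_fin sqr_ge0.
have := prob_multiple_jumps_le (c_ge0 _ _) (edge_poisson N_poisson e) (lexx 0) t0.
by rewrite subr0.
Qed.

Definition total_rate e : R :=
  fine (\esum_(e' in [set: edge S]) (meet_rate c (neighbourhood e) e')%:E).

Lemma total_rate_ge0 e : 0 <= total_rate e.
Proof.
by rewrite fine_ge0// esum_ge0// => e' _; rewrite lee_fin meet_rate_ge0.
Qed.

Lemma two_jumps_le F t : 0 <= t ->
  outer_le P (two_jumps F t) (\sum_(e <- F) edge_rate c e * t ^+ 2 * total_rate e)%:E.
Proof.
move=> t0.
have r0 e : 0 <= edge_rate c e * t ^+ 2 by rewrite mulr_ge0 ?sqr_ge0// /edge_rate.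
rewrite -fset_esum; last by move=> e; rewrite mulr_ge0// total_rate_ge0.
apply: outer_le_bigcup => e _; first by rewrite lee_fin mulr_ge0// total_rate_ge0.
have fin : (\esum_(e' in [set: edge S]) (meet_rate c (neighbourhood e) e')%:E
    <= (total_rate e)%:E)%E.
  rewrite fineK// ge0_fin_numE; first exact: meet_rate_fin.
  by apply: esum_ge0 => e' _; rewrite lee_fin meet_rate_ge0.
apply: (@outer_le_sub _ _ _ P _ _ _ _ (@subset_refl _ _) (esumZ_le (r0 e) fin)).
apply: outer_le_bigcup => e' _; first by rewrite lee_fin mulr_ge0// meet_rate_ge0.
rewrite /meet_rate.
have [ee'|ee'] := eqVneq e' e.
  exists set0; split => //; first by move=> w [].
  by rewrite measure0 lee_fin mulr_ge0// mulr_ge0// /edge_rate.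
case: (boolP (meets _ e')) => mA; last first.
  exists set0; split => //; first by move=> w [].
  by rewrite measure0 mul0r mulr0.
have ee : e != e' by rewrite eq_sym.
have := prob_two_jumps_le N_poisson ee (lexx 0) t0.
apply: outer_le_sub; first by move=> w [].
by rewrite subr0 mul1r lee_fin le_eqVlt; apply/orP; left; apply/eqP; ring.
Qed.

(** The constant C depends on F, but the term of order t only carries the tail eps. *)
Lemma semigroup_estimate (F : {fset edge S}) eps :
  (\esum_(e in ~` [set` F]) (meet_rate c A e)%:E <= eps%:E)%E ->
  exists2 C, 0 <= C & forall t sigma, 0 <= t ->
   `|semigroup P N t f sigma -
      (f sigma + \sum_(e <- F) D e sigma * fine (P (jump1 t e)))|
    <= 2 * M * (t * eps) + C * t ^+ 2.
Proof.
move=> hF.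
(* A crude bound for the error, used only on an event of probability O(t ^ 2). *)
pose b := 2 * M + \sum_(e <- F) 2 * M.
have b0 : 0 <= b by rewrite addr_ge0 ?sumr_ge0//; move=> *; rewrite mulr_ge0.
pose C0 := \sum_(e <- F) edge_rate c e ^+ 2 + \sum_(e <- F) edge_rate c e * total_rate e.
have C00 : 0 <= C0.
  rewrite addr_ge0// sumr_ge0// => e _; first exact: sqr_ge0.
  by rewrite mulr_ge0// ?total_rate_ge0// /edge_rate.
exists (b * C0); first exact: mulr_ge0.
move=> t sigma t0.
pose s := [seq (D e sigma, jump1 t e) | e <- F].
have sumE w : f sigma + \sum_(i <- s) i.1 * \1_(i.2) w = linearization F t sigma w.
  by rewrite big_map.
have -> : \sum_(e <- F) D e sigma * fine (P (jump1 t e)) =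
   \sum_(i <- s) i.1 * fine (P i.2) by rewrite big_map.
pose Q := multiple_jump F t `|` (two_jumps F t `|` irregular).
have PQ : outer_le P Q (t ^+ 2 * C0)%:E.
  have := outer_leU (multiple_jump_le F t0) (outer_leU (two_jumps_le F t0)
    (negligible_outer_le (regular_ae c_ge0 C1 N_poisson))).
  apply: outer_le_sub => //; rewrite adde0 -EFinD lee_fin /C0 mulrDr !mulr_sumr.
  rewrite lerD// ler_sum// => e _; rewrite le_eqVlt; apply/orP; left; apply/eqP; ring.
have nQ w : ~ Q w -> [/\ ~ irregular w, ~ two_jumps F t w & ~ multiple_jump F t w].
  by move=> h; split => h'; apply: h; [right; right|right; left|left].
rewrite -[b * C0 * _]mulrA [C0 * _]mulrC.
apply: (expectation_approx (B := far_jump F t) (Q := Q)) => //.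
- by move=> i /mapP[e _ ->] /=; apply: (measurable_incr (edge_poisson N_poisson e)).
- exact: far_jump_le.
- by rewrite mulr_ge0.
- by move=> w nf /nQ[rw n2 nm]; rewrite sumE; apply: linearization_exact.
- move=> w /nQ[rw n2 nm]; rewrite sumE; have [fj|nfj] := pselect (far_jump F t w).
    rewrite linearization_far// (le_trans (ler_normB _ _))//.
    have := f_bound sigma; have := f_bound (eta (config N w) t sigma).
    by rewrite /config; lra.
  by rewrite -linearization_exact// subrr normr0 mulr_ge0.
- move=> w; rewrite sumE /linearization opprD addrA (le_trans (ler_normB _ _))//.
  rewrite lerD//.
    rewrite (le_trans (ler_normB _ _))//.
    have := f_bound sigma; have := f_bound (eta (config N w) t sigma).
    by rewrite /config; lra.
  rewrite (le_trans (ler_norm_sum _ _ _))// ler_sum// => e _.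
  rewrite normrM -[leRHS]mulr1 ler_pM//; first exact: exchange_diff_bound.
  by rewrite indicE; case: (_ \in _); rewrite ?normr1 ?normr0.
Qed.

Lemma rate_jump1 e t : 0 <= t ->
  `|fine (P (jump1 t e)) - edge_rate c e * t| <= (edge_rate c e * t) ^+ 2.
Proof.
move=> t0; rewrite (prob_incr (edge_poisson N_poisson e))// subr0 /=.
have r0 : 0 <= edge_rate c e * t by rewrite mulr_ge0// /edge_rate.
rewrite /poisson_weight expr1 (_ : 1`! = 1)%N// divr1.
move: r0; set r := edge_rate c e * t => r0.
have h1 := expR_ge1Dx (- r); have h2 : expR (- r) <= 1 by rewrite expR_le1; lra.
rewrite ler_norml; apply/andP; split; nra.
Qed.

Lemma difference_quotient_estimate eps : 0 < eps ->
  exists2 C, 0 <= C & forall t sigma, 0 < t ->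
   `|difference_quotient P N f t sigma - generator_series c f sigma| <= 4 * M * eps + C * t.
Proof.
move=> eps0.
have [F [hF hgen]] := generator_series_approx c_ge0 c_sym c_diag C1 M_ge0 f_bound f_local eps0.
have [C C0 hS] := semigroup_estimate hF.
pose C2 := \sum_(e <- F) 2 * M * edge_rate c e ^+ 2.
have C20 : 0 <= C2 by apply: sumr_ge0 => e _; rewrite mulr_ge0 ?sqr_ge0// mulr_ge0.
exists (C + C2); first exact: addr_ge0.
move=> t sigma t0; have t0' := ltW t0.
have h1 := hS t sigma t0'; have h2 := hgen sigma.
set G := \sum_(e <- F) gen_term c f e sigma in h2.
set L := \sum_(e <- F) _ in h1.
have h3 : `|L - t * G| <= C2 * t ^+ 2.
  rewrite /L /G /C2 mulr_sumr mulr_suml -sumrB.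
  rewrite (le_trans (ler_norm_sum _ _ _))// ler_sum// => e _.
  have -> : D e sigma * fine (P (jump1 t e)) - t * gen_term c f e sigma =
     D e sigma * (fine (P (jump1 t e)) - edge_rate c e * t).
    by rewrite /gen_term /edge_rate /exchange_diff; ring.
  rewrite normrM -mulrA -exprMn ler_pM//; first exact: exchange_diff_bound.
  exact: rate_jump1.
rewrite /difference_quotient; set T := semigroup P N t f sigma in h1 *.
have -> : (T - f sigma) / t - generator_series c f sigma =
   ((T - (f sigma + L)) + (L - t * G) - t * (generator_series c f sigma - G)) / t.
  by field; rewrite gt_eqF.
rewrite normrM normfV (gtr0_norm t0) ler_pdivrMr//.
have h4 : `|t * (generator_series c f sigma - G)| <= t * (2 * M * eps).
  by rewrite normrM (gtr0_norm t0) ler_wpM2l.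
rewrite (le_trans (ler_normB _ _))//.
have := ler_normD (T - (f sigma + L)) (L - t * G).
rewrite expr2 in h1 h3; nra.
Qed.

Lemma generator_limit_series : generator_limit P N f (generator_series c f).
Proof.
split; first exact: (generator_series_continuous c_ge0 c_sym c_diag C1 M_ge0 f_bound f_local).
move=> W /uniform_nbhs[E [entE subW]].
move: entE; rewrite -entourage_from_ballE => -[e /= e0 ballE].
have M0 := M_ge0.
have eps0 : 0 < e / (2 * (4 * M + 1)) by rewrite divr_gt0//; lra.
have epsM : e / (2 * (4 * M + 1)) * (2 * (4 * M + 1)) = e by rewrite divfK//; lra.
have [C C0 hC] := difference_quotient_estimate eps0.
move: eps0 epsM hC; move: (e / _) => eps eps0 epsM hC.
have d0 : 0 < eps / (C + 1) by rewrite divr_gt0//; lra.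
have dM : eps / (C + 1) * (C + 1) = eps by rewrite divfK//; lra.
move: d0 dM; move: (eps / _) => delta d0 dM.
near=> t; apply: subW => sigma _; apply: ballE => /=.
have t0 : 0 < t by near: t; exact: nbhs_right_gt.
have td : t < delta by near: t; exact: nbhs_right_lt.
rewrite /ball /= distrC; apply: le_lt_trans (hC t sigma t0) _.
have : C * t <= C * delta by rewrite ler_wpM2l// ltW.
by rewrite -epsM; nra.
Unshelve. all: end_near. Qed.

Lemma generator_limit_unique (g1 g2 : conf S -> R) :
  generator_limit P N f g1 -> generator_limit P N f g2 -> g1 = g2.
Proof.
have close (g : conf S -> R) e : 0 < e -> generator_limit P N f g ->
    \forall t \near 0^'+, forall sigma, `|g sigma - difference_quotient P N f t sigma| < e.
  move=> e0 [_ lim].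
  apply: (lim [set h | forall sigma, `|g sigma - h sigma| < e]).
  apply/uniform_nbhs; exists [set xy : R * R | ball xy.1 e xy.2]; split.
    exact: (entourage_ball _ (PosNum e0)).
  by move=> h hh sigma; apply: hh.
move=> l1 l2; apply/funext => sigma; apply/eqP; rewrite -subr_eq0 -normr_le0.
apply/ler_addgt0Pr => e e0; rewrite add0r.
have e2 : 0 < e / 2 by rewrite divr_gt0.
have [t [/(_ sigma) + /(_ sigma)]] := @filter_ex _ _
  (at_right_proper_filter (0 : R)) _ (filterI (close _ _ e2 l1) (close _ _ e2 l2)).
rewrite !ltr_norml ler_norml => /andP[h1 h2] /andP[h3 h4]; apply/andP; split; lra.
Qed.

Lemma generatorE : generator P N f = generator_series c f.
Proof.
rewrite /generator; apply: xget_subset1; first exact: generator_limit_series.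
by move=> g1 g2; exact: generator_limit_unique.
Qed.

End generator_estimate.

Theorem proposition3p4 (R : realType) (S : countType)
    (S_infinite : infinite_set [set: S])
    (c : S -> S -> R)
    (c_ge0 : forall x y, 0 <= c x y)
    (c_sym : forall x y, c x y = c y x)
    (c_diag : forall x, c x x = 0)
    (C1 : forall x, (site_rate_ereal c x < +oo)%E)
    (C2 : non_explosive c)
    (d : measure_display) (Om : measurableType d) (P : probability Om R)
    (N : S -> S -> R -> Om -> nat)
    (N_poisson : poisson_family P c N)
    (f : conf S -> R) (f_local : local_fun f) :
  [/\ generator_domain P N f,
      forall eta : conf S,
        generator P N f eta =
        family_sum (fun x : S => family_sum (fun y : S =>
          c x y * (eta x)%:R * (1 - (eta y)%:R)
          * (f (exchange eta x y) - f eta))),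
      forall eta : conf S,
        generator P N f eta =
        family_sum (fun e : edge S =>
          c (efst e) (esnd e)
          * (f (exchange eta (efst e) (esnd e)) - f eta)),
      abs_convergent_in_C (fun (p : S * S) (eta : conf S) =>
          c p.1 p.2 * (eta p.1)%:R * (1 - (eta p.2)%:R)
          * (f (exchange eta p.1 p.2) - f eta)) &
      abs_convergent_in_C (fun (e : edge S) (eta : conf S) =>
          c (efst e) (esnd e)
          * (f (exchange eta (efst e) (esnd e)) - f eta))].
Proof.
have [A lf] := local_onP f_local; have [M M0 fM] := local_on_bounded lf.
have lim := generator_limit_series c_ge0 c_sym c_diag C1 N_poisson M0 fM lf.
have genE := generatorE c_ge0 c_sym c_diag C1 N_poisson M0 fM lf.
split.
- by split; [exact: local_on_continuous lf|exists (generator_series c f)].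
- move=> eta; rewrite genE.
  exact: (generator_series_pairs c_ge0 c_sym c_diag C1 M0 fM lf).
- by move=> eta; rewrite genE.
- exact: (gen_pair_abs_convergent c_ge0 c_sym c_diag C1 M0 fM lf).
- exact: (gen_term_abs_convergent c_ge0 c_sym c_diag C1 M0 fM lf).
Qed.
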